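(* Let $\mathfrak{H}=\mathfrak{H}_0\oplus\mathfrak{H}_1$ be an orthogonal decomposition of a separable complex Hilbert space with $\dim\mathfrak{H}_1=1$. Let $A_0$ and $A_1$ be bounded self-adjoint operators on $\mathfrak{H}_0$ and $\mathfrak{H}_1$ respectively, let $V:\mathfrak{H}_1\to\mathfrak{H}_0$ be a bounded linear operator, and let $$\mathbf{B}=\begin{pmatrix} A_0 & V \\ V^* & A_1 \end{pmatrix}$$ on $\mathfrak{H}$. Assume that $\operatorname{Ran}V$ is one-dimensional and that $\mathfrak{H}_0$ is the cyclic subspace for $A_0$ generated by $\operatorname{Ran}V$ (i.e. the closed linear span of $\{A_0^n y : y\in\operatorname{Ran}V,\ n\ge 0\}$ is $\mathfrak{H}_0$). Let $S_{\mathrm{pp}}$ denote the set of all eigenvalues of $\mathbf{B}$. Then there exist a minimal support $S_{\mathrm{s}}\subset\mathbb{R}$ of the singular part of the spectral measure of $\mathbf{B}$ with $S_{\mathrm{pp}}\subset S_{\mathrm{s}}$ and, for every $\lambda\in S_{\mathrm{s}}$, a densely defined linear operator $X_\lambda$ from $\mathfrak{H}_0$ to $\mathfrak{H}_1$ such that, writing $\Psi(\lambda)=\mathcal{G}(\mathfrak{H}_0,X_\lambda)$ for the graph subspace of $X_\lambda$, the following hold. (i) For any $\lambda\in S_{\mathrm{sc}}:=S_{\mathrm{s}}\setminus S_{\mathrm{pp}}$, the subspace $\Psi(\lambda)$ is a dense non-closed subspace of $\mathfrak{H}$, and $X_\lambda$ is a non-closed densely defined operator which is a strong solution of the Riccati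 equation $A_1X-XA_0-XVX+V^*=0$. (ii) For any $\lambda\in S_{\mathrm{pp}}$, the subspace $\Psi(\lambda)$ is a closed subspace of $\mathfrak{H}$ of codimension $1$, and $X_\lambda:\mathfrak{H}_0\to\mathfrak{H}_1$ is a bounded operator solving the Riccati equation $A_1X-XA_0-XVX+V^*=0$. Moreover, $X_\lambda$ is an isolated point, in the operator norm topology, of the set of all bounded solutions to this Riccati equation. For each $\lambda\in S_{\mathrm{s}}$ the subspace $\Psi(\lambda)$ is invariant with respect to $\mathbf{B}$, and the mapping $\Psi$ from $S_{\mathrm{s}}$ to the set $\mathcal{M}(\mathbf{B})$ of all (not necessarily closed) linear subspaces of $\mathfrak{H}$ invariant with respect to $\mathbf{B}$ is injective.
   Context: For a densely defined (possibly unbounded, not necessarily closed or closable) linear operator $X$ from $\mathfrak{H}_0$ to $\mathfrak{H}_1$ with domain $\operatorname{Dom}(X)$, the graph subspace is $\mathcal{G}(\mathfrak{H}_0,X)=\{x_0\oplus Xx_0 : x_0\in\operatorname{Dom}(X)\}\subset\mathfrak{H}$. Such an $X$ is a strong solution to the Riccati equation $A_1X-XA_0-XVX+V^*=0$ if $(A_0+VX)x\in\operatorname{Dom}(X)$ and $A_1Xx-X(A_0+VX)x+V^*x=0$ for every $x\in\operatorname{Dom}(X)$. A bounded solution is a bounded operator $X$ defined on all of $\mathfrak{H}_0$ that satisfies the equation. A (not necessarily closed) linear subspace $L\subset\mathfrak{H}$ is invariant with respect to $\mathbf{B}$ if $\mathbf{B}L\subset L$. A measurable, not necessarily closed, set $S\subset\mathbb{R}$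 is a support of a measure $\nu$ if $\nu(\mathbb{R}\setminus S)=0$. A support $S$ is minimal if every measurable subset $S'\subset S$ with $\nu(S')=0$ has Lebesgue measure zero. The singular part of the (projection-valued) spectral measure $\mathsf{E}_{\mathbf{B}}$ is $\delta\mapsto\mathsf{E}_{\mathbf{B}}(\delta)P_{\mathrm{s}}$, where $P_{\mathrm{s}}$ is the orthogonal projection onto the subspace of all $x\in\mathfrak{H}$ for which $\langle x,\mathsf{E}_{\mathbf{B}}(\cdot)x\rangle$ is singular with respect to Lebesgue measure; the notions of support and minimal support are applied to it verbatim. *)

(* Defs.v *)
From HB Require Import structures.
From mathcomp Require Import all_boot all_order all_algebra.
From mathcomp Require Import complex.
From mathcomp Require Import all_classical all_reals all_analysis.
From mathcomp Require Import ring.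
Import numFieldNormedType.Exports.
Import Order.TTheory GRing.Theory Num.Theory.

Set Implicit Arguments.
Unset Strict Implicit.
Unset Printing Implicit Defensive.

Local Open Scope classical_set_scope.
Local Open Scope complex_scope.
Local Open Scope ring_scope.

(* Complex Hilbert spaces. The norm and its topology come from the normed      *)
(* module structure over R[i]; hdot is linear in its first argument and        *)
(* conjugate-linear in its second one.                                         *)
HB.mixin Record isHilbert (R : realType) H of CompleteNormedModule R[i] H := {
  hdot : {dot H for (@Num.conj_op R[i])};
  hdotE : forall x : H, `|x| ^+ 2 = hdot x x
}.

#[short(type="hilbertType")]
HB.structure Definition Hilbert (R : realType) :=
  {H of isHilbert R H & CompleteNormedModule R[i] H}.

(* The library's norm on a product is the sup norm; dsum is an alias of the    *)
(* product type carrying the inner product <x.1, y.1> + <x.2, y.2> instead.    *)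
Definition dsum (R : realType) (H0 H1 : hilbertType R) : Type := (H0 * H1)%type.

Section DirectSum.
Variables (R : realType) (H0 H1 : hilbertType R).
Local Notation C := R[i].
Local Notation H := (dsum H0 H1).

HB.instance Definition _ := GRing.Lmodule.copy H (H0 * H1)%type.

Definition dsum_norm (x : H) : C := sqrtC (`|x.1| ^+ 2 + `|x.2| ^+ 2).

Let sqn_ge0 (x : H) : 0 <= `|x.1| ^+ 2 + `|x.2| ^+ 2.
Proof. by rewrite addr_ge0 ?exprn_ge0. Qed.

Let dsum_norm_ge0 x : 0 <= dsum_norm x.
Proof. by rewrite sqrtC_ge0. Qed.

Let dsum_norm_sqr x : dsum_norm x ^+ 2 = `|x.1| ^+ 2 + `|x.2| ^+ 2.
Proof. by rewrite sqrtCK. Qed.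

Lemma ler_dsum_normD x y : dsum_norm (x + y) <= dsum_norm x + dsum_norm y.
Proof.
rewrite -(@ler_pXn2r _ 2)// ?nnegrE ?addr_ge0// sqrrD !dsum_norm_sqr.
apply: (@le_trans _ _ ((`|x.1| + `|y.1|) ^+ 2 + (`|x.2| + `|y.2|) ^+ 2)).
  by apply: lerD; rewrite ler_pXn2r ?nnegrE ?addr_ge0 ?ler_normD.
rewrite !sqrrD.
have le_xy : `|x.1| * `|y.1| + `|x.2| * `|y.2| <= dsum_norm x * dsum_norm y.
  rewrite -(@ler_pXn2r _ 2)// ?nnegrE ?addr_ge0 ?mulr_ge0//.
  rewrite exprMn !dsum_norm_sqr -subr_ge0.
  rewrite [leRHS](_ : _ = (`|x.1| * `|y.2| - `|x.2| * `|y.1|) ^+ 2); last by ring.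
  by rewrite real_exprn_even_ge0// rpredB ?rpredM ?normr_real.
rewrite -subr_ge0 [leRHS](_ : _ = (dsum_norm x * dsum_norm y
  - (`|x.1| * `|y.1| + `|x.2| * `|y.2|)) *+ 2); last by ring.
by rewrite mulrn_wge0// subr_ge0.
Qed.

Lemma dsum_normZ (a : C) x : dsum_norm (a *: x) = `|a| * dsum_norm x.
Proof.
rewrite /dsum_norm /= !normrZ !exprMn -mulrDr sqrtCM ?nnegrE ?exprn_ge0//.
by rewrite exprCK.
Qed.

Lemma dsum_norm_eq0 x : dsum_norm x = 0 -> x = 0.
Proof.
move=> /eqP; rewrite sqrtC_eq0 paddr_eq0 ?exprn_ge0//.
rewrite !expf_eq0/= !normr_eq0 => /andP[/eqP x1 /eqP x2].
by case: x x1 x2 => a b /= -> ->.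
Qed.

HB.instance Definition _ :=
  Lmodule_isNormed.Build C H ler_dsum_normD dsum_normZ dsum_norm_eq0.

Lemma dsum_normE (x : H) : `|x| = dsum_norm x. Proof. by []. Qed.

Let le_norm1 (x : H) : `|x.1| <= `|x|.
Proof.
rewrite dsum_normE -(@ler_pXn2r _ 2)// ?nnegrE// dsum_norm_sqr.
by rewrite lerDl exprn_ge0.
Qed.

Let le_norm2 (x : H) : `|x.2| <= `|x|.
Proof.
rewrite dsum_normE -(@ler_pXn2r _ 2)// ?nnegrE// dsum_norm_sqr.
by rewrite lerDr exprn_ge0.
Qed.

Let le_normD (x : H) : `|x| <= `|x.1| + `|x.2|.
Proof.
rewrite dsum_normE -(@ler_pXn2r _ 2)// ?nnegrE ?addr_ge0// dsum_norm_sqr.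
by rewrite sqrrD addrAC lerDl mulrn_wge0 ?mulr_ge0.
Qed.

Lemma dsum_complete (F : set_system H) : ProperFilter F -> cauchy F -> cvg F.
Proof.
move=> FF /cauchyP Fc.
have cv1 : cvg ((fun x : H => x.1) @ F).
  apply: cauchy_cvg; apply/cauchyP => e e0.
  have [x Fx] := Fc e e0; exists x.1.
  rewrite /fmap /=; apply: filterS Fx => y xy; rewrite -ball_normE /=.
  by apply: le_lt_trans (le_norm1 (x - y)) _; move: xy; rewrite -ball_normE.
have cv2 : cvg ((fun x : H => x.2) @ F).
  apply: cauchy_cvg; apply/cauchyP => e e0.
  have [x Fx] := Fc e e0; exists x.2.
  rewrite /fmap /=; apply: filterS Fx => y xy; rewrite -ball_normE /=.
  by apply: le_lt_trans (le_norm2 (x - y)) _; move: xy; rewrite -ball_normE.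
move: cv1 cv2 => /cvg_ex[/= l1 /cvgrPdist_lt cv1] /cvg_ex[/= l2 /cvgrPdist_lt cv2].
apply/cvg_ex; exists ((l1, l2) : H); apply/cvgrPdist_lt => e e0.
near=> x; apply: le_lt_trans (le_normD _) _.
rewrite [ltRHS]splitr ltrD//.
- by near: x; apply: cv1; rewrite divr_gt0.
- by near: x; apply: cv2; rewrite divr_gt0.
Unshelve. all: by end_near. Qed.

HB.instance Definition _ := Uniform_isComplete.Build H dsum_complete.

Definition dsum_dot (x y : H) : C := hdot x.1 y.1 + hdot x.2 y.2.

Let dsum_dotBl (y : H) : zmod_morphism (dsum_dot^~ y).
Proof. by move=> a b; rewrite /dsum_dot !linearBl /= opprD addrACA. Qed.

Let dsum_dotBr (x : H) : zmod_morphism (dsum_dot x).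
Proof. by move=> a b; rewrite /dsum_dot !linearBr /= opprD addrACA. Qed.

Let dsum_dotZl (y : H) : scalable_for *%R (dsum_dot^~ y).
Proof. by move=> a b; rewrite /dsum_dot !linearZl_LR /= mulrDr. Qed.

Let dsum_dotZr (x : H) : scalable_for (@Num.conj_op C \; *%R) (dsum_dot x).
Proof. by move=> a b; rewrite /dsum_dot !linearZr_LR /= mulrDr. Qed.

HB.instance Definition _ := isBilinear.Build C H H C *%R
  (@Num.conj_op C \; *%R) dsum_dot dsum_dotBl dsum_dotBr dsum_dotZl dsum_dotZr.

Lemma dsum_dot_herm (x y : H) :
  dsum_dot x y = (-1) ^+ false * (dsum_dot y x)^*.
Proof.
by rewrite expr0 mul1r /dsum_dot rmorphD/= [hdot x.1 _]hermC [hdot x.2 _]hermC !mul1r.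
Qed.

HB.instance Definition _ := isHermitianSesquilinear.Build C H false
  (@Num.conj_op C) dsum_dot dsum_dot_herm.

Lemma dsum_dotE (x : H) : `|x| ^+ 2 = dsum_dot x x.
Proof. by rewrite dsum_normE dsum_norm_sqr !hdotE. Qed.

Lemma dsum_dot_gt0 (x : H) : x != 0 -> 0 < dsum_dot x x.
Proof. by move=> x0; rewrite -dsum_dotE exprn_gt0// normr_gt0. Qed.

HB.instance Definition _ := isDotProduct.Build C H dsum_dot dsum_dot_gt0.

HB.instance Definition _ := isHilbert.Build R H dsum_dotE.

End DirectSum.

Section Spaces.
Variable R : realType.

Definition separable_space (T : topologicalType) :=
  exists2 D : set T, countable D & dense D.

Definition subspace_of (H : hilbertType R) (L : set H) :=
  L 0 /\ forall (a : R[i]) x y, L x -> L y -> L (a *: x + y).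

Definition closed_span (H : hilbertType R) (G : set H) : set H :=
  closure (smallest (@subspace_of H) G).

Definition one_dimensional (H : hilbertType R) (L : set H) :=
  exists2 e : H, e != 0 & L = [set a *: e | a in [set: R[i]]].

Definition codimension1 (H : hilbertType R) (L : set H) :=
  subspace_of L /\
  exists2 v : H, ~ L v & forall x, exists a : R[i], L (x - a *: v).

(* On a closed subspace L this is the orthogonal projection onto L; elsewhere  *)
(* the value is 0 when x has no decomposition along L and its complement.      *)
Definition orthproj (H : hilbertType R) (L : set H) (x : H) : H :=
  xget 0 [set y | L y /\ forall z, L z -> hdot (x - y) z = 0].

End Spaces.

Section BoundedOperators.
Variable R : realType.

Definition bounded_op (H K : hilbertType R) (f : H -> K) :=
  exists M : R[i], forall x, `|f x| <= M * `|x|.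

Definition opnorm (H K : hilbertType R) (f : H -> K) : R :=
  sup [set complex.Re `|f x| | x in [set x : H | `|x| <= 1]].

Definition selfadjoint (H : hilbertType R) (f : H -> H) :=
  forall x y, hdot (f x) y = hdot x (f y).

(* The adjoint of a bounded operator exists by the Riesz theorem and is unique. *)
Definition adjoint (H K : hilbertType R) (f : H -> K) (y : K) : H :=
  xget 0 [set z | forall x, hdot (f x) y = hdot x z].

Definition block_op (H0 H1 : hilbertType R) (A0 : H0 -> H0) (V : H1 -> H0)
    (A1 : H1 -> H1) (x : dsum H0 H1) : dsum H0 H1 :=
  (A0 x.1 + V x.2, adjoint V x.1 + A1 x.2).

Definition cyclic_subspace (H : hilbertType R) (A : H -> H) (Y : set H) :=
  closed_span [set iter n A y | n in [set: nat] & y in Y].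

(* Real eigenvalues only, which are all of them when f is self-adjoint. *)
Definition eigenvalues (H : hilbertType R) (f : H -> H) : set R :=
  [set l | exists2 x : H, x != 0 & f x = l%:C *: x].

Definition invariant_subspace (H : hilbertType R) (f : H -> H) (L : set H) :=
  subspace_of L /\ f @` L `<=` L.

End BoundedOperators.

Section UnboundedOperators.
Variables (R : realType) (H0 H1 : hilbertType R).

(* The values outside of the domain are irrelevant. *)
Record unbounded_op := UnboundedOp {
  op_dom : set H0;
  op_fun :> H0 -> H1;
  op_dom_subspace : subspace_of op_dom;
  op_linear : forall (a : R[i]) x y, op_dom x -> op_dom y ->
    op_fun (a *: x + y) = a *: op_fun x + op_fun y
}.

Definition graph (X : unbounded_op) : set (dsum H0 H1) :=
  [set ((x, X x) : dsum H0 H1) | x in op_dom X].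

Definition densely_defined (X : unbounded_op) := dense (op_dom X).

Definition closed_op (X : unbounded_op) := closed (graph X).

Variables (A0 : H0 -> H0) (V : H1 -> H0) (A1 : H1 -> H1).

Definition strong_solution (X : unbounded_op) :=
  forall x, op_dom X x ->
    op_dom X (A0 x + V (X x)) /\
    A1 (X x) - X (A0 x + V (X x)) + adjoint V x = 0.

Definition bounded_solutions : set (H0 -> H1) :=
  [set X | [/\ linear X, bounded_op X &
    forall x, A1 (X x) - X (A0 x) - X (V (X x)) + adjoint V x = 0]].

End UnboundedOperators.

Definition opnorm_isolated (R : realType) (H K : hilbertType R)
    (S : set (H -> K)) (X : H -> K) :=
  S X /\ exists2 e : R, 0 < e & forall Y, S Y -> opnorm (Y \- X) < e -> Y = X.

Section SpectralMeasure.
Variables (R : realType) (H : hilbertType R).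

Definition orthogonal_projection (P : H -> H) :=
  [/\ linear P, forall x, P (P x) = P x & selfadjoint P].

(* A projection-valued measure on the Borel sets of R: countable additivity is *)
(* the requirement that every d |-> <E d x, x> be a measure, pvm_scalar E x.   *)
Record pvm := Pvm {
  pvm_fun :> set R -> H -> H;
  pvm_scalar : H -> {measure set R -> \bar R};
  pvm_proj : forall d, measurable d -> orthogonal_projection (pvm_fun d);
  pvm_setT : forall x, pvm_fun setT x = x;
  pvm_scalarE : forall x d, measurable d ->
    pvm_scalar x d = (complex.Re (hdot (pvm_fun d x) x))%:E
}.

(* B is the integral of t dE(t), stated for the quadratic forms, which         *)
(* determine the sesquilinear forms by polarization.                           *)
Definition is_spectral_measure (B : H -> H) (E : pvm) :=
  forall x, (pvm_scalar E x).-integrable setT EFin /\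
    hdot (B x) x = (\int[pvm_scalar E x]_t t)%:C.

Definition singular_subspace (E : pvm) : set H :=
  [set x | exists2 N : set R, measurable N &
    lebesgue_measure N = 0%E /\ pvm_scalar E x (~` N) = 0%E].

Definition singular_part (E : pvm) (d : set R) (x : H) : H :=
  E d (orthproj (singular_subspace E) x).

Definition support_of (nu : set R -> H -> H) (S : set R) :=
  measurable S /\ forall x, nu (~` S) x = 0.

Definition minimal_support (nu : set R -> H -> H) (S : set R) :=
  support_of nu S /\
  forall S', measurable S' -> S' `<=` S -> (forall x, nu S' x = 0) ->
    lebesgue_measure S' = 0%E.

End SpectralMeasure.

(* Main.v *)
Require Import Defs.
From HB Require Import structures.
From mathcomp Require Import all_boot all_order all_algebra.
From mathcomp Require Import complex.
From mathcomp Require Import all_classical all_reals all_analysis.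
From mathcomp Require Import ring lra.
Import numFieldNormedType.Exports.
Import Order.TTheory GRing.Theory Num.Theory.

Set Implicit Arguments.
Unset Strict Implicit.
Unset Printing Implicit Defensive.

Local Open Scope classical_set_scope.
Local Open Scope complex_scope.
Local Open Scope ring_scope.

(* Let e = (0, e1) span H1. Self-adjointness and cyclicity of Ran V make e      *)
(* cyclic for B. Put Psi l = Ran(B - l) when l is not an eigenvalue and         *)
(* Psi l = ker(B - l)^perp when it is. These subspaces are B-invariant, and     *)
(* whenever e is not in Psi l they are graphs of operators from H0 to H1.       *)
(* Moreover Psi l = Psi l' with l != l' would make Psi l the whole space, since *)
(* (B - l) x - (B - l') x is a multiple of x. For an eigenvalue e is never in   *)
(* Psi l because e is cyclic; otherwise e lies in Psi l iff e = (B - l) y,      *)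
(* which forces the measure of [l - r, l + r] with respect to <E(.)e, e> to be  *)
(* at most r^2 |y|^2, and a covering argument shows that such l form a null set *)
(* T of that measure. Let N be a Lebesgue null set of maximal <E(.)e, e>        *)
(* measure: then (N \ T) together with the countably many eigenvalues is a      *)
(* Lebesgue null support of the singular part, hence a minimal one. Finally,    *)
(* bounded solutions correspond to eigenvectors (g, e1) of B, and orthogonality *)
(* of eigenvectors puts two of them at distance at least sqrt 2 in norm.        *)

(** A subspace that contains Ran(B - l) is B-invariant ([Psi_invariant]). If it also meets the
    summand H1 only in 0, it is the graph of an operator ([subspace_graph]), and invariance of a
    graph gives the Riccati equation ([graph_strong_solution]). So the task is to find enough l for
    which [Psi] misses e.

    Let mu be the scalar spectral measure of e. As e is cyclic ([block_op_cyclic]), mu-null sets are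
    null for every vector ([pvm_ac_cyclic]). If e = (B - l) y, then mu of [l - r, l + r] is at most
    |y|^2 r^2 ([pvm_scalar_range]), and [square_small_cover] encloses all such l in a mu-null set.
    Discarding it from a Lebesgue null set exhausting the singular part of mu ([exhausting_set]) and
    adding the eigenvalues gives the support ([singular_support]).

    Off the eigenvalues [Psi] is dense ([Psi_dense]) and misses e, hence is not closed. At an
    eigenvalue it is the orthogonal complement of an eigenvector (f, e1), so the operator is x |-> -
    <x, f> e1. Every bounded solution arises from such an eigenvector ([functional_representation],
    [bounded_solution_eigenvector]); simplicity of eigenvalues and orthogonality of eigenvectors
    then isolate it ([bounded_solution_isolated]). *)

Section HilbertSpace.
Variables (R : realType) (H : hilbertType R).
Implicit Types (x y z : H) (r : R) (a : R[i]).

(** * Squared norm and real inner product *)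

Definition sqn x : R := complex.Re (hdot x x).
Definition rdot x y : R := complex.Re (hdot x y).

Lemma ReD (a b : R[i]) : complex.Re (a + b) = complex.Re a + complex.Re b.
Proof. by case: a b => [? ?] []. Qed.

Lemma ReN a : complex.Re (- a) = - complex.Re a.
Proof. by case: a. Qed.

Lemma ReZ r a : complex.Re (r%:C * a) = r * complex.Re a.
Proof. by case: a => ? ? /=; rewrite mul0r subr0. Qed.

Lemma hdotC x y : hdot x y = (hdot y x)^*.
Proof. by rewrite [LHS]hermC expr0 mul1r. Qed.

Lemma sqn_ge0 x : 0 <= sqn x.
Proof.
have : 0 <= hdot x x by rewrite -hdotE exprn_ge0.
by rewrite lecE /= => /andP[].
Qed.

Lemma hdotxx x : hdot x x = (sqn x)%:C.
Proof.
apply/esym/RRe_real/ger0_real.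
by rewrite -hdotE exprn_ge0.
Qed.

Lemma hilbert_normE x : `|x| = (Num.sqrt (sqn x))%:C.
Proof.
apply/eqP; rewrite -(@eqrXn2 _ 2)//; last by rewrite ler0c sqrtr_ge0.
by rewrite hdotE hdotxx -rmorphXn/= sqr_sqrtr ?sqn_ge0.
Qed.

Lemma normr_le x r : 0 <= r -> (`|x| <= r%:C) = (sqn x <= r ^+ 2).
Proof.
move=> r0; rewrite hilbert_normE lecR -(@ler_pXn2r _ 2) ?nnegrE ?sqrtr_ge0//.
by rewrite sqr_sqrtr ?sqn_ge0.
Qed.

Lemma sqn_eq0 x : sqn x = 0 -> x = 0.
Proof. by move=> x0; apply: normr0_eq0; rewrite hilbert_normE x0 sqrtr0. Qed.

Lemma sqn0 : sqn 0 = 0.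
Proof. by rewrite /sqn linear0l. Qed.

Lemma rdotC x y : rdot x y = rdot y x.
Proof. by rewrite /rdot hdotC; case: (hdot y x). Qed.

Lemma rdotDl x y z : rdot (x + y) z = rdot x z + rdot y z.
Proof. by rewrite /rdot linearDl ReD. Qed.

Lemma rdotDr x y z : rdot z (x + y) = rdot z x + rdot z y.
Proof. by rewrite /rdot linearDr ReD. Qed.

Lemma rdotZl r x y : rdot (r%:C *: x) y = r * rdot x y.
Proof. by rewrite /rdot linearZl_LR /= ReZ. Qed.

Lemma rdotZr r x y : rdot y (r%:C *: x) = r * rdot y x.
Proof. by rewrite rdotC rdotZl rdotC. Qed.

Lemma rdotxx x : rdot x x = sqn x. Proof. by []. Qed.

Lemma sqnD x y : sqn (x + y) = sqn x + sqn y + rdot x y *+ 2.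
Proof.
rewrite -!rdotxx rdotDl !rdotDr (rdotC y x); ring.
Qed.

Lemma sqnN x : sqn (- x) = sqn x.
Proof. by rewrite /sqn linearNl linearNr opprK. Qed.

Lemma rdotNr x y : rdot x (- y) = - rdot x y.
Proof. by rewrite /rdot linearNr ReN. Qed.

Lemma sqnB x y : sqn (x - y) = sqn x + sqn y - rdot x y *+ 2.
Proof. by rewrite sqnD sqnN rdotNr mulNrn. Qed.

Lemma sqnZ r x : sqn (r%:C *: x) = r ^+ 2 * sqn x.
Proof. by rewrite -!rdotxx rdotZl rdotZr mulrA. Qed.

(** Cauchy-Schwarz: the vector x minus its component along y has nonnegative squared norm. *)
Lemma rdot_sqr x y : rdot x y ^+ 2 <= sqn x * sqn y.
Proof.
have [y0|y0] := eqVneq (sqn y) 0.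
  by rewrite (sqn_eq0 y0) /rdot linear0r sqn0 mulr0 expr0n.
have yp : 0 < sqn y by rewrite lt0r y0 sqn_ge0.
have := sqn_ge0 (x - (rdot x y / sqn y)%:C *: y).
rewrite sqnB sqnZ rdotZr => h.
have {h} : 0 <= (sqn x * sqn y - rdot x y ^+ 2) / sqn y.
  apply: le_trans h _; rewrite le_eqVlt; apply/orP; left; apply/eqP.
  by field.
by rewrite pmulr_lge0 ?invr_gt0// subr_ge0.
Qed.

(** Reduces complex orthogonality to a complex subspace to vanishing of [rdot], tested on x and on i
    x. *)
Lemma hdot_rdot x y : hdot x y = rdot x y +i* (- rdot ('i%C *: x) y).
Proof.
rewrite /rdot linearZl_LR /=; case: (hdot x y) => u v /=.
by rewrite mul0r mul1r sub0r opprK.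
Qed.

End HilbertSpace.

(** * Nearest points and orthogonal vectors *)

Section Projection.
Variables (R : realType) (H : hilbertType R).
Implicit Types (x y z : H) (r : R) (L : set H).

Lemma normr_lt x r : 0 <= r -> (`|x| < r%:C) = (sqn x < r ^+ 2).
Proof.
move=> r0; rewrite hilbert_normE ltcR -(@ltr_pXn2r _ 2) ?nnegrE ?sqrtr_ge0//.
by rewrite sqr_sqrtr ?sqn_ge0.
Qed.

Lemma complex_gt0P (e : R[i]) : 0 < e -> exists2 r : R, 0 < r & e = r%:C.
Proof.
case: e => a b; rewrite ltcE /= => /andP[/eqP -> a0].
by exists a.
Qed.

Lemma sqn_cauchy_cvg (u : nat -> H) :
  (forall e : R, 0 < e -> exists N, forall n m, (N <= n)%N -> (N <= m)%N ->
    sqn (u n - u m) < e) ->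
  exists p, forall e : R, 0 < e -> exists N, forall n, (N <= n)%N ->
    sqn (p - u n) < e.
Proof.
move=> uC; have : cvg (u @ \oo).
  apply: cauchy_cvg; apply/cauchyP => e /complex_gt0P[r r0 ->].
  have [N uN] := uC (r ^+ 2) (exprn_gt0 _ r0).
  exists (u N); exists N => // n /= Nn.
  by rewrite -ball_normE /= normr_lt ?ltW// uN.
move=> /cvg_ex[/= p /cvgrPdist_lt up]; exists p => e e0.
have [|N _ uN] := up (Num.sqrt e)%:C; first by rewrite ltcR sqrtr_gt0.
exists N => n Nn; have := uN n Nn.
by rewrite /= normr_lt ?sqrtr_ge0// sqr_sqrtr// ltW.
Qed.

Lemma subspaceZ L (a : R[i]) x : subspace_of L -> L x -> L (a *: x).
Proof. by move=> [L0 LD] Lx; rewrite -[_ *: _]addr0; exact: LD. Qed.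

Lemma subspaceD L x y : subspace_of L -> L x -> L y -> L (x + y).
Proof. by move=> [L0 LD] Lx Ly; rewrite -[x]scale1r; exact: LD. Qed.

Lemma subspaceB L x y : subspace_of L -> L x -> L y -> L (x - y).
Proof. by move=> [L0 LD] Lx Ly; rewrite addrC -scaleN1r; exact: LD. Qed.

(** Projection theorem for a subspace that may fail to be closed: a minimizing sequence in L
    converges to some p in the closure of L, and x - p is the required vector. *)
Lemma ortho_vector L x r : subspace_of L -> 0 < r ->
  (forall l, L l -> r <= sqn (x - l)) ->
  exists2 g, g != 0 & forall l, L l -> hdot l g = 0.
Proof.
move=> sL r0 rL.
set A := [set sqn (x - l) | l in L]; set d := inf A.
have A0 : A !=set0 by exists (sqn (x - 0)), 0 => //; case: sL.
have lA : has_lbound A by exists 0 => _ [l _ <-]; exact: sqn_ge0.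
have dle l : L l -> d <= sqn (x - l) by move=> Ll; apply: ge_inf => //; exists l.
have /choice[u uP] (n : nat) : exists l, L l /\ sqn (x - l) < d + n.+1%:R^-1.
  have [_ [l Ll <-] lt] := @inf_adherent _ A n.+1%:R^-1 ltac:(by []) (conj A0 lA).
  by exists l.
have Lu n : L (u n) by case: (uP n).
have [p up] : exists p, forall e : R, 0 < e -> exists N, forall n, (N <= n)%N ->
    sqn (p - u n) < e.
  apply: sqn_cauchy_cvg => e e0.
  have [N Ne] : exists N : nat, N.+1%:R^-1 < e / 4.
    have e4 : 0 < e / 4 by rewrite divr_gt0.
    by have /ltr_add_invr[N]: 0 < e / 4 := e4; rewrite add0r; exists N.
  exists N => n m Nn Nm.
  have kN k : (N <= k)%N -> k.+1%:R^-1 <= N.+1%:R^-1 :> R.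
    by move=> Nk; rewrite lef_pV2 ?posrE// ler_nat.
  have := uP n; have := uP m => -[_ um] [_ un].
  have := kN _ Nn; have := kN _ Nm => km kn.
  (* The midpoint of [u n] and [u m] lies in L; with the parallelogram identity this bounds the
     squared distance by 4/(N+1). *)
  have mid : d *+ 4 <= sqn ((x - u n) + (x - u m)).
    have -> : x - u n + (x - u m) = 2%:R%:C *: (x - 2^-1%:C *: (u n + u m)).
      rewrite scalerBr scalerA -rmorphM/= divff// scale1r.
      by rewrite (rmorph_nat (real_complex R)) scaler_nat addrACA -opprD mulr2n.
    have -> : d *+ 4 = 2%:R ^+ 2 * d by ring.
    rewrite sqnZ ler_pM2l ?exprn_gt0//; apply: dle; apply: subspaceZ => //.
    exact: subspaceD.
  have -> : u n - u m = (x - u m) - (x - u n) by rewrite opprB [RHS]addrC addrA subrK.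
  rewrite sqnB; move: mid; rewrite sqnD (rdotC (x - u n)) => mid.
  move: um un km kn Ne mid; move: (n.+1%:R^-1) (m.+1%:R^-1) (N.+1%:R^-1).
  move: (sqn _) (sqn _) (rdot _ _) => s1 s2 s3 t1 t2 t3 *.
  lra.
exists (x - p).
  apply/eqP => xp.
  have [N uN] := up r r0.
  have := uN N (leqnn _); have := rL _ (Lu N).
  by move/subr0_eq: xp => ->; move=> h1 /(le_lt_trans h1); rewrite ltxx.
have key l : L l -> rdot l (x - p) = 0.
  move=> Ll.
  (* Split x - p at [u n]. The first term is small because [u n] is almost minimal, by comparison
     with the best point on the line through [u n] along l; the second is small by
     Cauchy-Schwarz. *)
  have small e : 0 < e -> rdot l (x - p) ^+ 2 <= e * sqn l *+ 4.
    move=> e0.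
    have [M Me] : exists N : nat, N.+1%:R^-1 < e.
      by have /ltr_add_invr[N] := e0; rewrite add0r; exists N.
    have [N uN] := up e e0; set n := maxn N M.
    have {}Me : n.+1%:R^-1 < e.
      by apply: le_lt_trans Me; rewrite lef_pV2 ?posrE// ler_nat ltnS leq_maxr.
    have {}uN := uN n (leq_maxl _ _).
    have h1 : rdot l (x - u n) ^+ 2 <= e * sqn l.
      have [l0|l0] := eqVneq (sqn l) 0.
        by rewrite (sqn_eq0 l0) /rdot linear0l sqn0 mulr0 expr0n.
      have lp : 0 < sqn l by rewrite lt0r l0 sqn_ge0.
      set t := rdot l (x - u n) / sqn l.
      have := dle (u n + t%:C *: l) (subspaceD sL (Lu n) (subspaceZ t%:C sL Ll)).
      rewrite opprD addrA sqnB sqnZ rdotZr (rdotC (x - u n)).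
      have [_ un] := uP n.
      have -> : t ^+ 2 * sqn l = rdot l (x - u n) ^+ 2 / sqn l.
        by rewrite /t; field.
      have -> : t * rdot l (x - u n) = rdot l (x - u n) ^+ 2 / sqn l.
        by rewrite /t; field.
      rewrite -ler_pdivrMr//; move: un Me; move: (n.+1%:R^-1) (sqn _) (_ / _) => *.
      lra.
    have h2 : rdot l (u n - p) ^+ 2 <= e * sqn l.
      apply: le_trans (rdot_sqr _ _) _; rewrite mulrC ler_wpM2r ?sqn_ge0//.
      by rewrite -sqnN opprB ltW.
    have -> : x - p = (x - u n) + (u n - p) by rewrite addrA subrK.
    rewrite rdotDr.
    have := sqr_ge0 (rdot l (x - u n) - rdot l (u n - p)).
    nra.
  apply/eqP; rewrite -sqrf_eq0 eq_le sqr_ge0 andbT; apply/ler_addgt0Pl => e e0.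
  have s0 : 0 < sqn l + 1 by rewrite ltr_wpDl ?sqn_ge0.
  apply: le_trans (small (e / 4 / (sqn l + 1)) _) _.
    by rewrite !divr_gt0.
  have -> : e / 4 / (sqn l + 1) * sqn l *+ 4 = e * (sqn l / (sqn l + 1)).
    by field; rewrite gt_eqF.
  by rewrite addr0 ler_piMr ?(ltW e0)// ler_pdivrMr// mul1r lerDl.
move=> l Ll; rewrite hdot_rdot !key// ?oppr0//; exact: subspaceZ.
Qed.

End Projection.

(** * Null sets and exhaustion *)

Section NullSets.
Context {d : measure_display} {T : measurableType d} {R : realType}.
Implicit Types mu : {measure set T -> \bar R}.

Lemma measure_bigcup_eq0 mu (F : nat -> set T) : (forall k, measurable (F k)) ->
  (forall k, mu (F k) = 0%E) -> mu (\bigcup_k F k) = 0%E.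
Proof.
move=> mF F0; apply/negligibleP; first exact: bigcupT_measurable.
apply: negligible_bigcup => k; exists (F k); split => //.
Qed.

Lemma measureU_eq0 mu (A B : set T) : measurable A -> measurable B ->
  mu A = 0%E -> mu B = 0%E -> mu (A `|` B) = 0%E.
Proof.
move=> mA mB A0 B0; apply/eqP; rewrite eq_le measure_ge0 andbT.
by rewrite (le_trans (measureU2 _ mA mB))// [X in (X + _)%E]A0 [X in (_ + X)%E]B0 adde0.
Qed.

Lemma bigsetU_measure_le mu (F : nat -> set T) n (c : R) :
  (forall k, measurable (F k)) -> (forall k, (mu (F k) <= c%:E)%E) ->
  (mu (\big[setU/set0]_(k < n) F k) <= (n%:R * c)%:E)%E.
Proof.
move=> mF Fc; elim: n => [|n IH]; first by rewrite big_ord0 measure0 mul0r.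
rewrite big_ord_recr /=; apply: le_trans (measureU2 _ _ (mF n)) _.
  by apply: bigsetU_measurable => i _.
rewrite -natr1 mulrDl mul1r EFinD.
exact: leeD IH (Fc n).
Qed.

(** A union of members of Z with almost maximal measure attains the supremum, so no member can add
    mass to it. It will be used with Z the Lebesgue null sets and mu a spectral measure. *)
Lemma exhausting_set mu (Z : set (set T)) : (mu setT < +oo)%E -> Z set0 ->
  (forall F : nat -> set T, (forall k, measurable (F k)) ->
    (forall k, Z (F k)) -> Z (\bigcup_k F k)) ->
  exists N, [/\ measurable N, Z N &
    forall M, measurable M -> Z M -> mu (M `\` N) = 0%E].
Proof.
move=> muoo Z0 Zbigcup.
have ZU A B : measurable A -> measurable B -> Z A -> Z B -> Z (A `|` B).
  move=> mA mB ZA ZB; rewrite -bigcup2E.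
  by apply: Zbigcup; rewrite /bigcup2 => -[|[|k]] /=.
have mufin A : measurable A -> mu A \is a fin_num.
  move=> mA; rewrite ge0_fin_numE//; apply: le_lt_trans muoo.
  by apply: le_measure; rewrite ?inE.
set S := [set fine (mu N) | N in [set N | measurable N /\ Z N]].
have Sub : has_ubound S.
  exists (fine (mu setT)) => _ [N [mN _] <-].
  by rewrite fine_le ?mufin// le_measure ?inE.
have S0 : has_sup S.
  by split=> //; exists (fine (mu set0)), set0.
have /choice[F FP] (k : nat) : exists N, [/\ measurable N, Z N &
    sup S - k.+1%:R^-1 < fine (mu N)].
  have [_ [N [mN N0] <-] lt] := @sup_adherent _ S k.+1%:R^-1 ltac:(by []) S0.
  by exists N.
have mF k : measurable (F k) by case: (FP k).
have mN : measurable (\bigcup_k F k) by exact: bigcupT_measurable.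
have N0 : Z (\bigcup_k F k) by apply: Zbigcup => // k; case: (FP k).
exists (\bigcup_k F k); split=> // M mM M0.
set N := \bigcup_k F k in mN N0 *.
have le1 : sup S <= fine (mu N).
  apply/ler_addgt0Pr => e e0; have [k] := ltr_add_invr e0; rewrite add0r => ke.
  have [_ _ Fk] := FP k; rewrite -lerBlDr.
  apply: le_trans (_ : sup S - k.+1%:R^-1 <= _); first by rewrite lerB// ltW.
  rewrite (le_trans (ltW Fk))// fine_le ?mufin//.
  by rewrite le_measure ?inE//; exact: bigcup_sup.
have mMN : measurable (M `\` N) by exact: measurableD.
have le2 : fine (mu (N `|` M)) <= sup S.
  apply: ub_le_sup => //; exists (N `|` M) => //; split; first exact: measurableU.
  exact: ZU.
have : mu (N `|` (M `\` N)) = (mu N + mu (M `\` N))%E.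
  by rewrite measureU// setDE setICA setICr setI0.
rewrite setUDr// setDv setD0 => e.
have := le_trans le2 le1; rewrite e fineD ?mufin// gerDl => h.
apply/eqP; rewrite eq_le measure_ge0 andbT -(fineK (mufin _ mMN)) lee_fin.
exact: h.
Qed.

End NullSets.

(** * Sets on which a measure decays quadratically *)

Section SquareSmall.
Variables (R : realType) (mu : {measure set R -> \bar R}).

Let bounded_cover (A : set R) (n : nat) (c : R) : 0 <= c ->
  (forall l, A l -> - n%:R <= l < n%:R) ->
  (forall l r, A l -> 0 < r -> (mu `[(l - r)%R, (l + r)%R]%classic <= (c * r ^+ 2)%:E)%E) ->
  exists G, [/\ measurable G, A `<=` G & mu G = 0%E].
Proof.
move=> c0 An Ac.
pose h k : R := k.+1%:R^-1.
have h0 k : 0 < h k by rewrite /h invr_gt0.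
pose cell k j : set R := `[- n%:R + j%:R * h k, - n%:R + j.+1%:R * h k]%classic.
(* Only cells meeting A are kept: such a cell, of width [h k], lies in the interval of radius [h k]
   around a point of A. *)
pose F k j := if `[< A `&` cell k j !=set0 >] then cell k j else set0.
have mF k j : measurable (F k j).
  by rewrite /F; case: asboolP => // _; exact: measurable_itv.
have Fc k j : (mu (F k j) <= (c * h k ^+ 2)%:E)%E.
  rewrite /F; case: asboolP => [meet|_]; last first.
    by rewrite measure0 lee_fin mulr_ge0 ?exprn_ge0 ?(ltW (h0 k)).
  case: meet => l [Al].
  rewrite /cell /= in_itv /= -natr1 mulrDl mul1r addrA => /andP[l1 l2].
  apply: le_trans (Ac _ _ Al (h0 k)).
  apply: le_measure; rewrite ?inE; [exact: measurable_itv..|].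
  move=> t /=; rewrite !in_itv /= => /andP[t1 t2]; apply/andP; split; lra.
(* The number of cells of width 1/(k+1) that fill [-n, n]. *)
pose m k := (2 * n * k.+1)%N.
pose G k := \big[setU/set0]_(j < m k) F k j.
have mG k : measurable (G k) by exact: bigsetU_measurable.
exists (\bigcap_k G k); split; first exact: bigcapT_measurable.
  move=> l Al k _; have /andP[l1 l2] := An _ Al.
  have y0 : 0 <= (l + n%:R) * k.+1%:R by rewrite mulr_ge0//; lra.
  pose j := Num.truncn ((l + n%:R) * k.+1%:R).
  have /andP[j1 j2] := Num.Theory.truncn_itv y0.
  have jm : (j < m k)%N.
    rewrite -(ltr_nat R); apply: le_lt_trans j1 _.
    rewrite /m !natrM ltr_pM2r//; lra.
  rewrite /G -bigcup_mkord; exists j => //.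
  have cl : cell k j l.
    have a1 : j%:R * h k <= l + n%:R by rewrite ler_pdivrMr.
    have a2 : l + n%:R <= j.+1%:R * h k by rewrite ler_pdivlMr// ltW.
    by rewrite /cell /= in_itv /=; apply/andP; split; lra.
  by rewrite /F; case: asboolP => // -[]; exists l.
have Gle k : (mu (\bigcap_k G k) <= ((2 * n)%:R * c * h k)%:E)%E.
  apply: le_trans (_ : mu (G k) <= _)%E.
    apply: le_measure; rewrite ?inE//; first exact: bigcapT_measurable.
    exact: bigcap_inf.
  apply: le_trans (bigsetU_measure_le (m k) (mF k) (Fc k)) _.
  rewrite lee_fin /m natrM le_eqVlt; apply/orP; left; apply/eqP.
  by rewrite /h; field; rewrite ?(addrC 1) ?nat1r ?natr1 pnatr_eq0.
apply/eqP; rewrite eq_le measure_ge0 andbT; apply/lee_addgt0Pr => e e0.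
rewrite add0e.
(* D may vanish, so the division below is by D + 1. *)
set D := (2 * n)%:R * c.
have D0 : 0 < D + 1 by rewrite ltr_wpDl ?mulr_ge0.
have [k] := ltr_add_invr (divr_gt0 e0 D0); rewrite add0r ltr_pdivlMr// => ke.
apply: le_trans (Gle k) _; rewrite lee_fin; apply: le_trans (ltW ke).
by rewrite mulrC ler_wpM2l ?lerDl// ltW// h0.
Qed.

(* A mesh of width h has O(1/h) cells in a bounded window, and each cell       *)
(* meeting A has measure O(h^2).                                               *)
Lemma square_small_cover (A : set R) (c : R) : 0 <= c ->
  (forall l r, A l -> 0 < r -> (mu `[(l - r)%R, (l + r)%R]%classic <= (c * r ^+ 2)%:E)%E) ->
  exists G, [/\ measurable G, A `<=` G & mu G = 0%E].
Proof.
move=> c0 Ac.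
have /choice[G GP] (n : nat) : exists G, [/\ measurable G,
    A `&` [set l | - n%:R <= l < n%:R] `<=` G & mu G = 0%E].
  by apply: (@bounded_cover _ n c) => // [l []|l r [Al _]]//; exact: Ac.
exists (\bigcup_n G n); split.
- by apply: bigcupT_measurable => n; case: (GP n).
- move=> l Al; pose n := (Num.truncn `|l|).+1; exists n => //.
  have [_ + _] := GP n; apply; split => //=.
  by have := truncnS_gt `|l|; rewrite ltr_norml => /andP[/ltW -> ->].
- by apply: measure_bigcup_eq0 => n; case: (GP n).
Qed.

End SquareSmall.

(** * Projection-valued measures and the operators they represent *)

Section Pvm.
Variables (R : realType) (H : hilbertType R) (E : pvm H).
Implicit Types (x y z : H) (r : R) (d A : set R).
Local Notation nu := (pvm_scalar E).

Lemma pvmP d (a : R[i]) x y : measurable d ->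
  E d (a *: x + y) = a *: E d x + E d y.
Proof. by move=> md; have [lE _ _] := pvm_proj E md; exact: lE. Qed.

Lemma pvm0 d : measurable d -> E d 0 = 0.
Proof.
by move=> md; have := pvmP (-1) 0 0 md; rewrite scaler0 addr0 scaleN1r addNr.
Qed.

Lemma pvmD d x y : measurable d -> E d (x + y) = E d x + E d y.
Proof. by move=> md; rewrite -[x]scale1r pvmP// !scale1r. Qed.

Lemma pvmZ d (a : R[i]) x : measurable d -> E d (a *: x) = a *: E d x.
Proof. by move=> md; rewrite -[_ *: _]addr0 pvmP// pvm0// addr0. Qed.

Lemma pvmB d x y : measurable d -> E d (x - y) = E d x - E d y.
Proof. by move=> md; rewrite pvmD// -scaleN1r pvmZ// scaleN1r. Qed.

Lemma pvmK d x : measurable d -> E d (E d x) = E d x.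
Proof. by move=> md; have [_ + _] := pvm_proj E md; exact. Qed.

Lemma pvm_sym d x y : measurable d -> hdot (E d x) y = hdot x (E d y).
Proof. by move=> md; have [_ _] := pvm_proj E md; exact. Qed.

Lemma pvm_sqn d x : measurable d -> nu x d = (sqn (E d x))%:E.
Proof. by move=> md; rewrite pvm_scalarE// /sqn -pvm_sym// pvmK. Qed.

Lemma pvm_scalar_setT x : nu x setT = (sqn x)%:E.
Proof. by rewrite pvm_sqn// pvm_setT. Qed.

Lemma pvm_scalar_lty x d : measurable d -> (nu x d < +oo)%E.
Proof. by move=> md; rewrite pvm_sqn// ltry. Qed.

Lemma pvm_eq0 d x : measurable d -> nu x d = 0%E <-> E d x = 0.
Proof.
move=> md; rewrite pvm_sqn//; split => [[/sqn_eq0]//|->].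
by rewrite sqn0.
Qed.

Lemma pvm_sqnC d x : measurable d -> sqn x = sqn (E d x) + sqn (E (~` d) x).
Proof.
move=> md; apply: EFin_inj; rewrite EFinD -!pvm_sqn//; last exact: measurableC.
have := measureU (nu x) md (measurableC md) (setICr d).
by rewrite setUv -pvm_scalar_setT.
Qed.

Lemma pvm_sqnB d x : measurable d -> sqn (x - E d x) = sqn x - sqn (E d x).
Proof.
move=> md; rewrite sqnB {2}/sqn.
have -> : rdot x (E d x) = sqn (E d x) by rewrite /sqn /rdot pvm_sym// pvmK.
rewrite -/(sqn _); ring.
Qed.

(** By Pythagoras |x - E d x|^2 = |x|^2 - |E d x|^2, and this is the mass that x puts outside d. *)
Lemma pvm_fix d x : measurable d -> nu x (~` d) = 0%E -> E d x = x.
Proof.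
move=> md /pvm_eq0 -/(_ (measurableC md)) x0.
have := pvm_sqnC x md; rewrite x0 sqn0 addr0 => h.
by apply/esym/subr0_eq/sqn_eq0; rewrite pvm_sqnB// -h subrr.
Qed.

Lemma pvm_scalar_proj d x : measurable d -> nu (E d x) (~` d) = 0%E.
Proof.
move=> md; apply/pvm_eq0; first exact: measurableC.
apply: sqn_eq0; have := pvm_sqnC (E d x) md; rewrite pvmK//.
by rewrite -{1}[sqn (E d x)]addr0 => /addrI <-.
Qed.

Lemma pvm_le A d x : measurable A -> measurable d -> A `<=` d ->
  nu x d = 0%E -> E A x = 0.
Proof.
move=> mA md Ad xd; apply/pvm_eq0 => //.
exact: subset_measure0 xd.
Qed.

Section Splitting.
Variables (d : set R) (x y : H).
Hypotheses (md : measurable d) (xd : nu x (~` d) = 0%E) (yd : nu y d = 0%E).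

Lemma pvm_scalarDl A : measurable A -> A `<=` d -> nu (x + y) A = nu x A.
Proof. by move=> mA Ad; rewrite !pvm_sqn// pvmD// (pvm_le mA md Ad yd) addr0. Qed.

Lemma pvm_scalarDr A : measurable A -> A `<=` ~` d -> nu (x + y) A = nu y A.
Proof.
by move=> mA Ad; rewrite !pvm_sqn// pvmD// (pvm_le mA (measurableC md) Ad xd) add0r.
Qed.

End Splitting.

Variable B : {linear H -> H}.
Hypotheses (sB : selfadjoint B) (EB : is_spectral_measure B E).

Lemma rdotB x : rdot (B x) x = \int[nu x]_t t.
Proof. by rewrite /rdot; have [_ ->] := EB x. Qed.

Lemma rintB d x : measurable d -> nu x (~` d) = 0%E ->
  \int[nu x]_t t = \int[nu x]_(t in d) t.
Proof.
move=> md xd; rewrite /Rintegral (negligible_integral (measurableC md))//.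
  by rewrite setTD setCK.
by have [] := EB x.
Qed.

(** The scalar measure of x + y agrees with that of x inside d and with that of y outside, so the
    integral of t splits. *)
Lemma rdotB_split d x y : measurable d -> nu x (~` d) = 0%E -> nu y d = 0%E ->
  rdot (B (x + y)) (x + y) = rdot (B x) x + rdot (B y) y.
Proof.
move=> md xd yd; have mCd := measurableC md.
have yCd : nu y (~` (~` d)) = 0%E by rewrite setCK.
rewrite !rdotB (rintB md xd) (rintB mCd yCd).
have -> : \int[nu (x + y)]_t t =
    \int[nu (x + y)]_(t in d) t + \int[nu (x + y)]_(t in ~` d) t.
  rewrite -Rintegral_setU//.
  - by rewrite setUv.
  - by rewrite setUv; have [] := EB (x + y).
  - by apply/disj_setPS; rewrite setICr.
congr (_ + _); rewrite /Rintegral; congr fine; apply: eq_measure_integral.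
  by move=> A mA Ad; rewrite (pvm_scalarDl x md yd mA Ad).
by move=> A mA Ad; rewrite (pvm_scalarDr y md xd mA Ad).
Qed.

(** By [rdotB_split] the cross terms of the quadratic form cancel; self-adjointness makes them
    equal, hence zero. *)
Lemma hdotB_eq0 d x y : measurable d -> nu x (~` d) = 0%E -> nu y d = 0%E ->
  hdot (B x) y = 0.
Proof.
move=> md xd yd.
have key z : nu z (~` d) = 0%E -> rdot (B z) y = 0.
  move=> zd; have := rdotB_split md zd yd.
  rewrite linearD rdotDl !rdotDr (rdotC (B y)).
  have -> : rdot z (B y) = rdot (B z) y by rewrite /rdot sB.
  move: (rdot (B z) y) => s; lra.
rewrite hdot_rdot -linearZ !key ?oppr0//.
apply/pvm_eq0; first exact: measurableC.
rewrite pvmZ; last exact: measurableC.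
by move/pvm_eq0: xd => ->; [rewrite scaler0|exact: measurableC].
Qed.

(** The form in which B commutes with E: the squared norm of E d (B x) pairs B x with a vector
    concentrated on d, while x is concentrated off d. *)
Lemma pvm_ker_invariant d x : measurable d -> E d x = 0 -> E d (B x) = 0.
Proof.
move=> md xd; apply: sqn_eq0; rewrite /sqn -pvm_sym// pvmK// hdotC.
rewrite -hdotC pvm_sym// (@hdotB_eq0 (~` d))//.
- exact: measurableC.
- by rewrite setCK; apply/pvm_eq0.
- exact: pvm_scalar_proj.
Qed.

Section LocalBound.
Variables (l r : R).
Hypothesis r0 : 0 < r.
Let I : set R := `[l - r, l + r]%classic.
Let mI : measurable I. Proof. exact: measurable_itv. Qed.
Let T x := B x - l%:C *: x.

Let T_local x : nu x (~` I) = 0%E -> nu (T x) (~` I) = 0%E.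
Proof.
have mCI := measurableC mI.
move=> /(pvm_eq0 _ mCI) x0; apply/(pvm_eq0 _ mCI).
by rewrite /T pvmB// pvmZ// x0 pvm_ker_invariant// scaler0 subr0.
Qed.

Let local_comb x y (a : R) : nu x (~` I) = 0%E -> nu y (~` I) = 0%E ->
  nu (x + a%:C *: y) (~` I) = 0%E.
Proof.
have mCI := measurableC mI.
move=> /(pvm_eq0 _ mCI) x0 /(pvm_eq0 _ mCI) y0; apply/(pvm_eq0 _ mCI).
by rewrite pvmD// pvmZ// x0 y0 scaler0 addr0.
Qed.

Let T_form x : nu x (~` I) = 0%E -> `|rdot (T x) x| <= r * sqn x.
Proof.
move=> xI; rewrite /T rdotDl rdotB (rintB mI xI) -scaleNr -(rmorphN (real_complex R)).
rewrite rdotZl rdotxx.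
have nI : fine (nu x I) = sqn x by rewrite pvm_sqn// pvm_fix.
have [iT _] := EB x.
have iI : (nu x).-integrable I EFin by exact: integrableS iT.
have ic (c : R) : (nu x).-integrable I (EFin \o cst c).
  apply: measurable_bounded_integrable => //; first exact: pvm_scalar_lty.
  exact: bounded_cst.
have lo : (l - r) * sqn x <= \int[nu x]_(t in I) t.
  rewrite -nI -Rintegral_cst//; apply: le_Rintegral => //; first exact: ic.
  by move=> t; rewrite /I /= in_itv /= => /andP[].
have hi : \int[nu x]_(t in I) t <= (l + r) * sqn x.
  rewrite -nI -Rintegral_cst//; apply: le_Rintegral => //; first exact: ic.
  by move=> t; rewrite /I /= in_itv /= => /andP[].
by rewrite ler_norml; apply/andP; split; lra.
Qed.

(** The bound on the quadratic form of the symmetric T becomes a bound on T by polarization: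
    subtract the form at x - T x / r from the form at x + T x / r. *)
Lemma local_bound x : nu x (~` I) = 0%E -> sqn (T x) <= r ^+ 2 * sqn x.
Proof.
move=> xI; have yI := T_local xI.
have := T_form (local_comb r^-1 xI yI).
have := T_form (local_comb (- r^-1) xI yI).
have TD u w (a : R) : T (u + a%:C *: w) = T u + a%:C *: T w.
  rewrite /T linearD linearZ /= scalerDr opprD addrACA; congr (_ + _).
  by rewrite scalerBr !scalerA mulrC.
have TC u w : rdot (T u) w = rdot u (T w).
  rewrite /T rdotDl rdotDr -!scaleNr -(rmorphN (real_complex R)) rdotZl rdotZr.
  by rewrite /rdot sB.
have form u w (a : R) : rdot (T (u + a%:C *: w)) (u + a%:C *: w) =
    rdot (T u) u + a ^+ 2 * rdot (T w) w + a * rdot (T u) w *+ 2.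
  rewrite TD; move: (TC w u) (rdotC w (T u)); move: (T u) (T w) => u' w' e1 e2.
  by rewrite !rdotDl !rdotDr !rdotZl !rdotZr e1 e2; ring.
rewrite !form !(sqnD x) !sqnZ !rdotZr rdotxx (rdotC x).
set s := sqn (T x); set a := rdot (T x) x; set b := rdot (T (T x)) (T x).
rewrite !ler_norml => /andP[h1 _] /andP[_ h2].
have {h1 h2} : 4 * r^-1 * s <= 2 * (r * (sqn x + r^-1 ^+ 2 * s)).
  by move: h1 h2; rewrite sqrrN; lra.
have -> : r * (sqn x + r^-1 ^+ 2 * s) = r * sqn x + r^-1 * s.
  by field; rewrite gt_eqF.
move=> h; have {h} : s / r <= r * sqn x by lra.
by rewrite ler_pdivrMr// => h; rewrite expr2 mulrAC.
Qed.

(** E I sends (B - l) x to (B - l) applied to E I x, where [local_bound] holds. *)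
Lemma pvm_scalar_range x : (nu (B x - l%:C *: x)%R I <= (sqn x * r ^+ 2)%:E)%E.
Proof.
set z := E I x; set w := x - z.
have wI : E I w = 0 by rewrite /w pvmB// pvmK// subrr.
have -> : nu (B x - l%:C *: x) I = (sqn (T z))%:E.
  rewrite pvm_sqn//; congr (sqn _)%:E.
  have -> : x = z + w by rewrite /w addrC subrK.
  rewrite linearD scalerDr opprD addrACA pvmD//.
  rewrite [X in _ + X]pvmB// pvmZ// pvm_ker_invariant// wI scaler0 subrr addr0.
  by apply: pvm_fix => //; apply: T_local; exact: pvm_scalar_proj.
rewrite lee_fin (le_trans (local_bound _))//; first exact: pvm_scalar_proj.
rewrite mulrC ler_wpM2r ?sqr_ge0// (pvm_sqnC x mI) lerDl.
exact: sqn_ge0.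
Qed.

End LocalBound.

End Pvm.

(** * Closure, density and orthogonality *)

Section Topology.
Variables (R : realType) (H : hilbertType R).
Implicit Types (x y z p : H) (L : set H).

Lemma closure_sqnP L p :
  closure L p <-> forall e : R, 0 < e -> exists2 l, L l & sqn (p - l) < e.
Proof.
split=> [Lp e e0|Lp A /nbhs_ballP[_ /complex_gt0P[r r0 ->] rA]].
  have s0 : 0 < Num.sqrt e by rewrite sqrtr_gt0.
  have [|l [Ll]] := Lp (ball p (Num.sqrt e)%:C).
    by apply: nbhsx_ballx; rewrite ltcR.
  rewrite -ball_normE /= normr_lt ?ltW// sqr_sqrtr ?ltW// => lp.
  by exists l.
have [l Ll lp] := Lp _ (exprn_gt0 2 r0).
exists l; split => //; apply: rA.
by rewrite -ball_normE /= normr_lt// ltW.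
Qed.

Lemma dense_closureP L : dense L <-> forall p, closure L p.
Proof.
split=> [dL p A|cL U [p Up] oU].
  rewrite nbhsE => -[U [oU Up] UA].
  have [l [Ul Ll]] := dL U (ex_intro _ p Up) oU.
  by exists l; split => //; exact: UA.
have [|l [Ll Ul]] := cL p U; first exact: open_nbhs_nbhs.
by exists l.
Qed.

Lemma closed_closureP L : closed L <-> closure L `<=` L.
Proof.
split=> [|cL]; first by move=> /closure_id <-.
apply/closure_id/seteqP; split => //.
exact: subset_closure.
Qed.

Lemma sqnD_le x y : sqn (x + y) <= 2 * (sqn x + sqn y).
Proof. by have := sqn_ge0 (x - y); rewrite sqnB sqnD; lra. Qed.

Lemma hdot_eq0C x y : hdot x y = 0 -> hdot y x = 0.
Proof. by rewrite [hdot y x]hdotC => ->; rewrite rmorph0. Qed.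

Lemma hdot_cvg0 x p : (forall e : R, 0 < e ->
  exists2 l, hdot l x = 0 & sqn (p - l) < e) -> hdot p x = 0.
Proof.
move=> Lp.
(* All complex multiples of x are treated, so that [hdot_rdot] recovers the complex product. *)
have key a : rdot p (a *: x) = 0.
  apply/eqP; rewrite -sqrf_eq0 eq_le sqr_ge0 andbT; apply/ler_addgt0Pr => e e0.
  have s0 : 0 < sqn (a *: x) + 1 by rewrite ltr_wpDl ?sqn_ge0.
  have [l lx lp] := Lp _ (divr_gt0 e0 s0).
  have -> : rdot p (a *: x) = rdot (p - l) (a *: x).
    by rewrite /rdot linearBl /= [hdot l _]linearZr_LR /= lx mulr0 subr0.
  rewrite add0r (le_trans (rdot_sqr _ _))//.
  rewrite (le_trans (ler_wpM2r (sqn_ge0 _) (ltW lp)))//.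
  by rewrite mulrAC ler_pdivrMr// ler_wpM2l ?lerDl// ltW.
apply: hdot_eq0C; rewrite hdot_rdot rdotC -[x in rdot p x]scale1r !(rdotC _ p).
by rewrite !key// oppr0.
Qed.

Lemma subspace_ortho x : subspace_of [set z | hdot z x = 0].
Proof.
split=> [|a y z /= y0 z0]; first by rewrite /= linear0l.
by rewrite linearPl /= y0 z0 mulr0 addr0.
Qed.

Lemma closed_ortho x : closed [set z | hdot z x = 0].
Proof. by apply/closed_closureP => p /closure_sqnP; exact: hdot_cvg0. Qed.

Lemma subspace_dense L : subspace_of L ->
  (forall g, (forall l, L l -> hdot l g = 0) -> g = 0) -> dense L.
Proof.
move=> sL Lperp; apply/dense_closureP => p; apply: contrapT => pL.
have [r r0 rL] : exists2 r : R, 0 < r & forall l, L l -> r <= sqn (p - l).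
  apply: contrapT => nr; apply: pL; apply/closure_sqnP => e e0.
  apply: contrapT => ne; apply: nr; exists e => // l Ll; rewrite leNgt.
  by apply/negP => lp; apply: ne; exists l.
have [g /eqP g0 gL] := ortho_vector sL r0 rL.
exact/g0/Lperp.
Qed.

(** [xget] returns either a vector that lies in L by specification or its default 0. *)
Lemma orthproj_closed L x : L 0 -> L (orthproj L x).
Proof.
by move=> L0; rewrite /orthproj; case: xgetP => // y _ [].
Qed.

End Topology.

(** * Eigenvalues of a self-adjoint operator *)

Section Eigenvectors.
Variables (R : realType) (H : hilbertType R) (B : {linear H -> H}).
Hypothesis sB : selfadjoint B.
Implicit Types (x y f g : H) (l : R).

Lemma eigen_real (c : R[i]) f : f != 0 -> B f = c *: f -> exists l : R, c = l%:C.
Proof.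
move=> f0 Bf; exists (complex.Re c).
have := sB f f; rewrite Bf linearZl_LR /= linearZr_LR /=.
have ff : hdot f f != 0.
  by rewrite -hdotE expf_neq0// normr_eq0.
move=> /(mulIf ff); case: c {Bf} => a b [/eqP].
by rewrite -subr_eq0 opprK -mulr2n mulrn_eq0 /= => /eqP ->.
Qed.

Lemma eigen_ortho l l' f g : B f = l%:C *: f -> B g = l'%:C *: g -> l != l' ->
  hdot f g = 0.
Proof.
move=> Bf Bg ll'; have := sB f g; rewrite Bf Bg linearZl_LR /= linearZr_LR /=.
rewrite [_^*]conjc_real => /eqP; rewrite -subr_eq0 -mulrBl mulf_eq0 -rmorphB /=.
case/orP => [/eqP|/eqP//]; move/complexI/eqP.
by rewrite subr_eq0 (negPf ll').
Qed.

Lemma unit_eigenvector l : eigenvalues B l ->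
  exists f, sqn f = 1 /\ B f = l%:C *: f.
Proof.
move=> [f f0 Bf]; have s0 : 0 < sqn f.
  rewrite lt0r sqn_ge0 andbT; apply: contraNN f0 => /eqP h.
  by rewrite (sqn_eq0 h).
exists ((Num.sqrt (sqn f))^-1%:C *: f); split; last first.
  by rewrite linearZ /= Bf scalerA mulrC -scalerA.
by rewrite sqnZ exprVn sqr_sqrtr ?ltW// mulVf// gt_eqF.
Qed.

(** Unit eigenvectors for distinct eigenvalues have squared distance 2, so points of D within 1/2 of
    each of them differ; D then indexes the eigenvalues. *)
Lemma countable_eigenvalues : separable_space H -> countable (eigenvalues B).
Proof.
move=> [D /countable_injP[j jinj] dD].
have /choice[g gP] (l : R) : exists p : H, eigenvalues B l ->
    D p /\ exists f, [/\ sqn f = 1, B f = l%:C *: f & sqn (f - p) < 4^-1].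
  have [ev|nev] := pselect (eigenvalues B l); last by exists 0.
  have [f [f1 Bf]] := unit_eigenvector ev.
  have /dense_closureP/(_ f)/closure_sqnP/(_ 4^-1)[//|p Dp pf] := dD.
  by exists p => _; split => //; exists f.
apply/countable_injP; exists (j \o g) => l l'; rewrite !inE => evl evl' /= jg.
have [Dl [f [f1 Bf fp]]] := gP _ evl; have [Dl' [f' [f1' Bf' fp']]] := gP _ evl'.
have gE : g l = g l' by apply: jinj; rewrite ?inE.
apply/eqP/negPn/negP => ll'.
have : sqn (f - f') = 2.
  rewrite sqnB /rdot (eigen_ortho Bf Bf' ll') f1 f1' /=; lra.
have -> : f - f' = (f - g l) + - (f' - g l) by rewrite opprB addrA subrK.
have := sqnD_le (f - g l) (- (f' - g l)); rewrite sqnN.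
by move: fp fp'; rewrite -gE; clear jg; lra.
Qed.

End Eigenvectors.

(** * Consequences of a cyclic vector *)

Section CyclicVector.
Variables (R : realType) (H : hilbertType R) (B : {linear H -> H}) (e : H).
Hypothesis sB : selfadjoint B.
Hypothesis cyclic_e : forall L : set H, subspace_of L -> closed L ->
  (forall x, L x -> L (B x)) -> L e -> forall x, L x.
Implicit Types (x y f g : H) (l : R).

(** The orthogonal complement of f is closed, B-invariant and contains e, hence contains f
    itself. *)
Lemma eigen_ortho_cyclic (c : R[i]) f : B f = c *: f -> hdot e f = 0 -> f = 0.
Proof.
move=> Bf ef.
have /= ff := cyclic_e (subspace_ortho f) (@closed_ortho _ _ f) _ ef f.
apply: sqn_eq0; rewrite /sqn ff// => x /= xf.
by rewrite sB Bf linearZr_LR /= xf mulr0.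
Qed.

Lemma normalized_eigenvector l : eigenvalues B l ->
  exists2 f, hdot e f = 1 & B f = l%:C *: f.
Proof.
move=> [f f0 Bf]; have ef : hdot e f != 0.
  by apply: contraNN f0 => /eqP /(eigen_ortho_cyclic Bf) ->.
exists ((hdot e f)^-1^* *: f); last first.
  by rewrite linearZ /= Bf !scalerA mulrC.
by rewrite linearZr_LR /= conjCK mulVf.
Qed.

(** Eigenvalues are simple: the difference of the two sides is an eigenvector orthogonal to e. *)
Lemma eigenspace_cyclic (c : R[i]) f g : B f = c *: f -> B g = c *: g ->
  hdot e f = 1 -> g = (hdot e g)^* *: f.
Proof.
move=> Bf Bg ef; apply/subr0_eq/(@eigen_ortho_cyclic c).
  by rewrite linearB linearZ /= Bf Bg scalerBr !scalerA mulrC.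
by rewrite linearBr linearZr_LR /= conjCK ef mulr1 subrr.
Qed.

Section SpectralType.
Variable E : pvm H.
Hypothesis EB : is_spectral_measure B E.

(** The cyclic vector has maximal spectral type, because the kernel of E d is closed, B-invariant
    and contains e. *)
Lemma pvm_ac_cyclic d x : measurable d -> pvm_scalar E e d = 0%E ->
  pvm_scalar E x d = 0%E.
Proof.
move=> md /(pvm_eq0 _ _ md) de; apply/(pvm_eq0 _ _ md).
apply: (cyclic_e (L := [set z | E d z = 0])) => //=.
- split=> [|a y z /= y0 z0]; first exact: pvm0.
  by rewrite /= pvmP// y0 z0 scaler0 addr0.
- apply/closed_closureP => p /closure_sqnP Lp /=.
  apply: sqn_eq0; apply/eqP; rewrite eq_le sqn_ge0 andbT.
  apply/ler_addgt0Pr => r r0; rewrite add0r; have [z /= z0 pz] := Lp r r0.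
  apply: le_trans (ltW pz); rewrite (pvm_sqnC E (p - z) md) pvmB// z0 subr0.
  by rewrite lerDl sqn_ge0.
- by move=> z z0; exact: pvm_ker_invariant.
Qed.

(** Sorting the l by a bound n on |y|^2 gives a uniform constant for [square_small_cover]; the
    countable union over n stays null. *)
Lemma range_null_cover : exists T : set R, [/\ measurable T,
  [set l | exists y, B y - l%:C *: y = e] `<=` T & pvm_scalar E e T = 0%E].
Proof.
have /choice[T TP] (n : nat) : exists T : set R, [/\ measurable T,
    [set l | exists2 y, B y - l%:C *: y = e & sqn y <= n%:R] `<=` T &
    pvm_scalar E e T = 0%E].
  apply: (square_small_cover (c := n%:R)) => // l r [y ye yn] r0.
  rewrite -{1}ye; apply: le_trans (pvm_scalar_range sB EB l r0 y) _.
  by rewrite lee_fin ler_wpM2r// sqr_ge0.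
exists (\bigcup_n T n); split.
- by apply: bigcupT_measurable => n; case: (TP n).
- move=> l [y ye]; exists (Num.truncn (sqn y)).+1 => //.
  have [_ + _] := TP (Num.truncn (sqn y)).+1; apply; exists y => //.
  exact/ltW/truncnS_gt.
- by apply: measure_bigcup_eq0 => n; case: (TP n).
Qed.

Lemma singular_support : separable_space H -> exists S : set R,
  [/\ minimal_support (singular_part E) S, eigenvalues B `<=` S &
      forall l, (S `\` eigenvalues B) l -> forall y, B y - l%:C *: y != e].
Proof.
move=> sepH; have cS := countable_eigenvalues sB sepH.
have mS : measurable (eigenvalues B) by exact: countable_measurable cS.
have [T [mT rT T0]] := range_null_cover.
have [N [mN N0 NP]] : exists N, [/\ measurable N, lebesgue_measure N = 0%E &
    forall M, measurable M -> lebesgue_measure M = 0%E ->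
    pvm_scalar E e (M `\` N) = 0%E].
  apply: (@exhausting_set _ _ _ (pvm_scalar E e)
    (fun N : set R => lebesgue_measure N = 0%E)).
  - exact: pvm_scalar_lty.
  - exact: measure0.
  - by move=> F mF F0; exact: measure_bigcup_eq0.
(* S is Lebesgue null, so minimality is immediate; removing T keeps e out of Ran(B - l). *)
pose S := (N `\` T) `|` eigenvalues B.
have mNT : measurable (N `\` T) by exact: measurableD.
have mSS : measurable S by exact: measurableU.
have S0 : lebesgue_measure S = 0%E.
  apply: measureU_eq0 => //; last exact: countable_lebesgue_measure0.
  exact: (subset_measure0 (mu := @lebesgue_measure R)) N0.
exists S; split; last 2 first.
- by move=> l; right.
- move=> l [[[Nl Tl] _ y|//]]; apply/eqP => ye; apply: Tl; apply: rT.
  by exists y.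
split; last first.
  by move=> S' mS' S'S _; exact: (subset_measure0 (mu := @lebesgue_measure R)) S0.
split=> // x; rewrite /singular_part.
have sing0 : singular_subspace E 0.
  exists set0 => //; split; first exact: measure0.
  by rewrite pvm_sqn ?setC0// pvm0// sqn0.
have [M mM [M0 xM]] := orthproj_closed x sing0.
set z := orthproj _ x in xM *.
(* The complement of S is covered by three sets null for z: z lives on the Lebesgue null set M,
   while M \ N and T are null for e. *)
apply: (pvm_le (d := (~` M `|` (M `\` N)) `|` T)) => //.
- exact: measurableC.
- apply: measurableU => //; apply: measurableU; first exact: measurableC.
  exact: measurableD.
- move=> t St; have [Tt|Tt] := pselect (T t); [by right|left].
  have [Mt|Mt] := pselect (M t); [right|by left].
  by split => // Nt; apply: St; left.
- apply: measureU_eq0 => //; last exact: pvm_ac_cyclic.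
    apply: measurableU; first exact: measurableC.
    exact: measurableD.
  apply: measureU_eq0 => //; first exact: measurableC.
    exact: measurableD.
  apply: pvm_ac_cyclic; first exact: measurableD.
  exact: NP.
Qed.

End SpectralType.

Definition Psi l : set H := if `[< eigenvalues B l >]
  then [set x | forall f, B f = l%:C *: f -> hdot x f = 0]
  else range (fun y => B y - l%:C *: y).

Lemma Psi_range l y : Psi l (B y - l%:C *: y).
Proof.
rewrite /Psi; case: asboolP => _; last by exists y.
move=> f Bf; rewrite linearBl /= linearZl_LR /= sB Bf linearZr_LR /=.
by rewrite [_^*]conjc_real subrr.
Qed.

Lemma Psi_eigen l f : B f = l%:C *: f -> hdot e f = 1 ->
  Psi l = [set x | hdot x f = 0].
Proof.
move=> Bf ef; rewrite /Psi asboolT; last first.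
  exists f => //; apply/eqP => f0; move: ef; rewrite f0 linear0r => /eqP.
  by rewrite eq_sym oner_eq0.
apply/seteqP; split => x /= xf; first exact: xf.
move=> g Bg; rewrite (eigenspace_cyclic Bf Bg ef) linearZr_LR /= xf mulr0//.
Qed.

Lemma Psi_subspace l : subspace_of (Psi l).
Proof.
rewrite /Psi; case: asboolP => _.
  split=> [f _|a x y /= xf yf f Bf]; first by rewrite linear0l.
  by rewrite linearPl /= xf// yf// mulr0 addr0.
split=> [|a _ _ [x _ <-] [y _ <-]].
  by exists 0; rewrite // linear0 scaler0 subr0.
exists (a *: x + y) => //.
by rewrite linearP !scalerBr scalerDr opprD !addrA !scalerA mulrC -!addrA
  [in RHS](addrCA _ (B y)).
Qed.

(** Write B x = (B - l) x + l x; the first term is in [Psi l] by [Psi_range]. *)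
Lemma Psi_invariant l x : Psi l x -> Psi l (B x).
Proof.
move=> Lx; have -> : B x = (B x - l%:C *: x) + l%:C *: x by rewrite subrK.
apply: subspaceD (Psi_subspace l) (Psi_range l x) _.
exact: subspaceZ (Psi_subspace l) Lx.
Qed.

(** A common subspace contains (B - l) e - (B - l') e = (l' - l) e. *)
Lemma Psi_inj l l' : ~ Psi l e -> Psi l = Psi l' -> l = l'.
Proof.
move=> ne eqP'; apply/eqP/negPn/negP => ll'; apply: ne.
have sP := Psi_subspace l.
have : Psi l ((B e - l%:C *: e) - (B e - l'%:C *: e)).
  by apply: subspaceB sP (Psi_range l e) _; rewrite eqP'; exact: Psi_range.
rewrite opprB addrC addrA subrK -scalerBl -rmorphB /= => /(subspaceZ (l' - l)^-1%:C sP).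
by rewrite scalerA -rmorphM /= mulVf ?scale1r// subr_eq0 eq_sym.
Qed.

(** A vector orthogonal to Ran(B - l) is in ker(B - l), by self-adjointness. *)
Lemma Psi_dense l : ~ eigenvalues B l -> dense (Psi l).
Proof.
move=> nev; apply: subspace_dense (Psi_subspace l) _ => g gP.
apply/eqP/negPn/negP => g0; apply: nev; exists g => //.
apply/subr0_eq/sqn_eq0; set w := _ - _.
have := gP _ (Psi_range l w); rewrite linearBl /= linearZl_LR /= sB.
move=> h; rewrite /sqn {2}/w linearBr linearZr_LR /= [_^*]conjc_real.
by rewrite [X in complex.Re X]h.
Qed.

(** The graph criterion: [Psi l] meets the line of e only in 0. *)
Lemma Psi_cyclic l (a : R[i]) : eigenvalues B l \/ (forall y, B y - l%:C *: y != e) ->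
  Psi l (a *: e) -> a = 0.
Proof.
have [ev _|nev [//|ran]] := pselect (eigenvalues B l).
  have [f ef Bf] := normalized_eigenvector ev.
  by rewrite (Psi_eigen Bf ef) /= linearZl_LR /= ef mulr1.
move=> ae; apply/eqP/negPn/negP => a0.
have := subspaceZ a^-1 (Psi_subspace l) ae; rewrite scalerA mulVf// scale1r.
rewrite /Psi asboolF// => -[y _ ye].
by have := ran y; rewrite ye eqxx.
Qed.

End CyclicVector.

(** * The complex Cauchy-Schwarz inequality *)

Section CauchySchwarz.
Variables (R : realType) (H : hilbertType R).
Implicit Types x y : H.

(** Multiplying x by the conjugate of h makes the product real, equal to |h|^2, so [rdot_sqr]
    applies. *)
Lemma hdot_norm_le x y : `|hdot x y| <= `|x| * `|y|.
Proof.
set h := hdot x y; have [->|h0] := eqVneq h 0.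
  by rewrite normr0 mulr_ge0.
have hE : h^* * h = ((complex.Re h) ^+ 2 + (complex.Im h) ^+ 2)%:C.
  by rewrite add_Re2_Im2 sqr_normc mulrC.
set s := (_ + _) in hE.
have s0 : 0 < s.
  by rewrite -ltcR -hE mulrC -[_^*]/(conjc h) -sqr_normc exprn_gt0// normr_gt0.
have e1 : rdot (h^* *: x) y = s.
  by rewrite /rdot linearZl_LR /= -/h hE.
have e2 : sqn (h^* *: x) = s * sqn x.
  rewrite /sqn linearZl_LR /= linearZr_LR /= conjCK mulrA hE -[s%:C * _]/(s%:C * _).
  by rewrite ReZ.
have := rdot_sqr (h^* *: x) y; rewrite e1 e2 expr2 -mulrA ler_pM2l// => le.
rewrite !hilbert_normE -rmorphM /= -sqrtrM ?sqn_ge0// normc_def lecR ler_sqrt//.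
by rewrite mulr_ge0 ?sqn_ge0.
Qed.

End CauchySchwarz.

(** * Graph subspaces and the Riccati equation *)

Section Graph.
Variables (R : realType) (H0 H1 : hilbertType R).
Local Notation H := (dsum H0 H1).

Lemma hdot_dsum (u w : H) : hdot u w = hdot u.1 w.1 + hdot u.2 w.2.
Proof. by []. Qed.

Lemma sqn_dsum (u : H) : sqn u = sqn u.1 + sqn u.2.
Proof. by rewrite /sqn hdot_dsum ReD. Qed.

Lemma graphP (X : unbounded_op H0 H1) (u : H) :
  graph X u <-> op_dom X u.1 /\ X u.1 = u.2.
Proof.
split=> [[x Xx <-] //|[Xu e]]; exists u.1 => //.
by rewrite e; case: u {Xu e}.
Qed.

Lemma subspace_graph (L : set H) : subspace_of L ->
  (forall y, L (0, y) -> y = 0) -> exists X : unbounded_op H0 H1, graph X = L.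
Proof.
move=> sL L0.
have Luniq x y y' : L (x, y) -> L (x, y') -> y = y'.
  move=> Ly Ly'; apply/subr0_eq/L0.
  by have := subspaceB sL Ly Ly'; rewrite -[_ - _]/(x - x, y - y') subrr.
pose D : set H0 := [set x | exists y, L (x, y)].
pose F x : H1 := xget 0 [set y | L (x, y)].
have FP x : D x -> L (x, F x).
  by move=> Dx; exact: (@xgetPex _ 0 [set y | L (x, y)] Dx).
have LD (a : R[i]) x x' y y' : L (x, y) -> L (x', y') -> L (a *: x + x', a *: y + y').
  by case: sL => _ LD; exact: LD.
have sD : subspace_of D.
  split=> [|a x x' [y Ly] [y' Ly']]; first by exists 0; case: sL.
  by exists (a *: y + y'); exact: LD.
have FD a x x' : D x -> D x' -> F (a *: x + x') = a *: F x + F x'.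
  move=> Dx Dx'; apply: Luniq (FP _ _) (LD _ _ _ _ _ (FP _ Dx) (FP _ Dx')).
  exact: sD.2.
exists (UnboundedOp sD FD); apply/seteqP; split=> [_ [x /= Dx <-]|[x y] Lxy].
  exact: FP.
apply/graphP; split => /=; first by exists y.
have Dx : D x by exists y.
exact: Luniq (FP _ Dx) Lxy.
Qed.

Lemma dense_graph_dom (X : unbounded_op H0 H1) :
  dense (graph X) -> densely_defined X.
Proof.
move=> /dense_closureP dX; apply/dense_closureP => p; apply/closure_sqnP => e e0.
have /closure_sqnP/(_ e e0)[l /graphP[Dl _]] := dX (p, 0).
rewrite sqn_dsum => /(le_lt_trans _) lt; exists l.1 => //.
by apply: lt; rewrite /= lerDl sqn_ge0.
Qed.

(** The image of (x, X x) lies on the graph exactly when its first component is in the domain and X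
    maps it to the second; this is the Riccati equation at x. *)
Lemma graph_strong_solution A0 V A1 (X : unbounded_op H0 H1) :
  (forall u, graph X u -> graph X (block_op A0 V A1 u)) ->
  strong_solution A0 V A1 X.
Proof.
move=> invX x Dx; have Gx : graph X (x, X x) by exists x.
have /graphP[/= D' ->] := invX _ Gx.
by split => //; rewrite addrAC (addrC (A1 _)) subrr.
Qed.

End Graph.

(** * The block operator over a one-dimensional H1 *)

Section RankOne.
Variables (R : realType) (H0 H1 : hilbertType R).
Variables (A0 : {linear H0 -> H0}) (A1 : {linear H1 -> H1}) (V : {linear H1 -> H0}).
Local Notation H := (dsum H0 H1).
Variable e1 : H1.
Hypotheses (e1_unit : hdot e1 e1 = 1) (e1_basis : forall y, y = hdot y e1 *: e1).

(** As e1 spans H1, the adjoint is explicit: x |-> <x, V e1> e1. *)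
Lemma adjointP x y : hdot (V y) x = hdot y (adjoint V x).
Proof.
apply: (@xgetPex _ 0 [set z | forall y, hdot (V y) x = hdot y z]).
exists (hdot x (V e1) *: e1) => z; rewrite {1}(e1_basis z) linearZ /=.
rewrite linearZl_LR /= [RHS]linearZr_LR /= -hdotC mulrC; congr (_ * _).
Qed.

Lemma block_op_linear :
  exists B : {linear H -> H}, (B : H -> H) = block_op A0 V A1.
Proof.
have adjE x : adjoint V x = hdot x (V e1) *: e1.
  by rewrite [LHS]e1_basis; congr (_ *: _); rewrite hdotC -adjointP -hdotC.
have lB : linear (block_op A0 V A1).
  move=> a u w; rewrite /block_op !linearP /= !adjE linearPl scalerDl.
  rewrite -[a *: (_, _) + _]/(a *: (A0 u.1 + V u.2) + (A0 w.1 + V w.2),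
    a *: (hdot u.1 (V e1) *: e1 + A1 u.2) + (hdot w.1 (V e1) *: e1 + A1 w.2)).
  by rewrite !scalerDr !scalerA; congr pair; rewrite addrACA.
pose f := GRing.isLinear.Build R[i] H H *:%R (block_op A0 V A1) lB.
by exists (HB.pack_for {linear H -> H} (block_op A0 V A1) f).
Qed.

Lemma block_op_selfadjoint : selfadjoint A0 -> selfadjoint A1 ->
  selfadjoint (block_op A0 V A1).
Proof.
move=> sA0 sA1 u w; rewrite !hdot_dsum /= !linearDl !linearDr /= sA0 sA1.
rewrite [hdot (adjoint V _) _]hdotC -!adjointP -hdotC.
by rewrite addrACA.
Qed.

(** L contains the summand H1, so second components can be subtracted. Hence L contains (V y, 0),
    then all (A0^n V y, 0), and their closed span. *)
Lemma block_op_cyclic : cyclic_subspace A0 (range V) = [set: H0] ->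
  forall L : set H, subspace_of L -> closed L ->
  (forall u, L u -> L (block_op A0 V A1 u)) -> L (0, e1) -> forall u, L u.
Proof.
move=> cyc L sL /closed_closureP cL BL Le.
have L2 y : L (0, y).
  rewrite (e1_basis y); have := subspaceZ (hdot y e1) sL Le.
  by rewrite -[_ *: (0, e1)]/(hdot y e1 *: (0 : H0), hdot y e1 *: e1) scaler0.
have L1 x y : L (x, y) -> L (x, 0).
  move=> Lxy; have := subspaceB sL Lxy (L2 y).
  by rewrite -[_ - _]/(x - 0, y - y) subr0 subrr.
suff L0 x : L (x, 0).
  move=> [x y]; have := subspaceD sL (L0 x) (L2 y).
  by rewrite -[_ + _]/(x + 0, 0 + y) addr0 add0r.
have : cyclic_subspace A0 (range V) x by rewrite cyc.
move=> /closure_sqnP clx; apply: cL; apply/closure_sqnP => r /clx[z zG zx].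
exists (z, 0); last by rewrite sqn_dsum /= subrr sqn0 addr0.
move: z zG {zx}; apply: smallest_sub => /=.
  split=> [|a u w /= Lu Lw]; first by case: sL.
  have := sL.2 a _ _ Lu Lw.
  by rewrite -[_ *: _ + _]/(a *: u + w, a *: (0 : H1) + 0) scaler0 addr0.
move=> _ [n _ [_ [y _ <-] <-]] /=; elim: n => [|n IH].
  by have := BL _ (L2 y); rewrite /block_op /= linear0 add0r; exact: L1.
by rewrite iterS; have := BL _ IH; rewrite /block_op /= linear0 addr0; exact: L1.
Qed.

End RankOne.

(** * Bounded solutions as eigenvectors *)

Section BoundedSolutions.
Variables (R : realType) (H0 H1 : hilbertType R).
Variables (A0 : {linear H0 -> H0}) (A1 : {linear H1 -> H1}) (V : {linear H1 -> H0}).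
Local Notation H := (dsum H0 H1).
Variable e1 : H1.
Hypotheses (e1_unit : hdot e1 e1 = 1) (e1_basis : forall y, y = hdot y e1 *: e1).
Hypotheses (sA0 : selfadjoint A0) (sA1 : selfadjoint A1).
Hypothesis cycV : cyclic_subspace A0 (range V) = [set: H0].
Variable B : {linear H -> H}.
Hypothesis BE : (B : H -> H) = block_op A0 V A1.
Implicit Types (f g : H0) (Y : H0 -> H1).

Let e : H := (0, e1).

Let sB : selfadjoint B.
Proof. by rewrite BE; exact: (block_op_selfadjoint V e1_basis). Qed.

Let cyclic_e (L : set H) : subspace_of L -> closed L ->
  (forall x, L x -> L (B x)) -> L e -> forall x, L x.
Proof. by rewrite BE; exact: (block_op_cyclic e1_basis). Qed.

Let sqn_e1 : sqn e1 = 1. Proof. by rewrite /sqn e1_unit. Qed.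

Lemma bounded_op_sqn Y : bounded_op Y ->
  exists2 K : R, 0 <= K & forall x, sqn (Y x) <= K * sqn x.
Proof.
move=> [M YM]; exists (complex.Re `|M| ^+ 2); first by rewrite sqr_ge0.
move=> x; set m := complex.Re `|M|.
have mE : `|M| = m%:C by rewrite /m RRe_real// normr_real.
have m0 : 0 <= m by rewrite -ler0c -mE.
have : `|Y x| <= (m * Num.sqrt (sqn x))%:C.
  apply: le_trans (YM x) _; rewrite rmorphM /= -mE -hilbert_normE.
  have Mx0 : 0 <= M * `|x| by apply: le_trans (YM x).
  by rewrite -(ger0_norm Mx0) normrM normr_id.
by rewrite normr_le ?mulr_ge0 ?sqrtr_ge0// exprMn sqr_sqrtr ?sqn_ge0.
Qed.

(** Riesz representation: a vector orthogonal to the graph of Y, rescaled to have second component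
    e1, supplies g. *)
Lemma functional_representation Y : linear Y -> bounded_op Y ->
  exists g, forall x, Y x = - hdot x g *: e1.
Proof.
move=> lY /bounded_op_sqn[K K0 YK].
pose L : set H := [set ((x, Y x) : H) | x in [set: H0]].
have sL : subspace_of L.
  split=> [|a _ _ [x _ <-] [y _ <-]].
    exists 0 => //; have := lY (-1) 0 0.
    by rewrite scaler0 addr0 scaleN1r addNr => ->.
  by exists (a *: x + y); rewrite // lY.
(* From 1 = |e1|^2 <= 2 (|e1 - Y x|^2 + K |x|^2), the squared distance of e to the graph is at least
   1 / (2 (K + 1)). *)
have K1 : 0 < 2 * (K + 1) by rewrite mulr_gt0// ltr_wpDl.
have [|l [x _ <-]|g g0 gL] := @ortho_vector _ _ L e (2 * (K + 1))^-1 sL.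
- by rewrite invr_gt0.
- rewrite sqn_dsum /= sub0r sqnN -[leLHS]mul1r ler_pdivrMr//.
  have := sqnD_le (e1 - Y x) (Y x); rewrite subrK sqn_e1 => h.
  have := YK x; have := sqn_ge0 x; have := sqn_ge0 (e1 - Y x).
  nra.
have gx x : hdot x g.1 + hdot (Y x) g.2 = 0 by apply: (gL (x, Y x)); exists x.
have g2 : hdot e1 g.2 != 0.
  apply: contraNN g0 => /eqP e1g.
  have g1 x : hdot x g.1 = 0.
    by have := gx x; rewrite (e1_basis (Y x)) linearZl_LR /= e1g mulr0 addr0.
  apply/eqP/sqn_eq0; rewrite sqn_dsum (_ : sqn g.1 = 0) ?add0r; last first.
    by rewrite /sqn g1.
  by rewrite /sqn {1}(e1_basis g.2) linearZl_LR /= e1g mulr0.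
exists ((hdot e1 g.2)^-1^* *: g.1) => x.
rewrite linearZr_LR /= conjCK [LHS]e1_basis; congr (_ *: _).
have := gx x; rewrite (e1_basis (Y x)) !linearZl_LR /= e1_unit mulr1 => h.
apply: (mulIf g2); rewrite mulNr mulrAC mulVf// mul1r.
by apply/eqP; rewrite -addr_eq0 addrC h.
Qed.

(** The graph of Y is B-invariant, hence so is its orthogonal complement, which is the line of (g,
    e1). *)
Lemma bounded_solution_eigenvector Y g : bounded_solutions A0 V A1 Y ->
  (forall x, Y x = - hdot x g *: e1) ->
  exists l : R, B ((g, e1) : H) = l%:C *: ((g, e1) : H).
Proof.
move=> [lY _ solY] Yg; set u : H := (g, e1).
have ortho x : hdot ((x, Y x) : H) u = 0.
  by rewrite hdot_dsum /= Yg linearZl_LR /= e1_unit mulr1 subrr.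
have YD x y : Y (x + y) = Y x + Y y.
  by have := lY 1 x y; rewrite !scale1r.
have inv x : B ((x, Y x) : H) = (A0 x + V (Y x), Y (A0 x + V (Y x))).
  rewrite BE /block_op /= YD; congr pair.
  by apply/subr0_eq; rewrite -[RHS](solY x) opprD [RHS]addrC !addrA.
have [c Bc] : exists c : R[i], B u = c *: u.
  exists (hdot (B u).2 e1); apply/subr0_eq; set h := _ - _.
  have h2 : h.2 = 0.
    rewrite /h -[(_ - _).2]/((B u).2 - hdot (B u).2 e1 *: e1).
    by rewrite -e1_basis subrr.
  have h1 x : hdot x h.1 = 0.
    have : hdot ((x, Y x) : H) h = 0.
      by rewrite /h linearBr /= linearZr_LR /= ortho mulr0 subr0 -sB inv ortho.
    by rewrite hdot_dsum h2 linear0r addr0.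
  by apply: sqn_eq0; rewrite sqn_dsum h2 sqn0 addr0 /sqn h1.
have u0 : u != 0.
  apply/eqP => u0; have : sqn u.2 = 0 by rewrite u0 sqn0.
  by rewrite /= sqn_e1 => /eqP; rewrite oner_eq0.
have [l cl] := eigen_real sB u0 Bc.
by exists l; rewrite Bc cl.
Qed.

(** Radius 1 suffices. For equal eigenvalues simplicity gives Z = Y; otherwise orthogonality gives
    <f, g> = -1, so |f - g| >= 1, and |f - g| is attained by Z - Y at the unit vector along f -
    g. *)
Lemma bounded_solution_isolated Y f :
  bounded_solutions A0 V A1 Y -> (forall x, Y x = - hdot x f *: e1) ->
  opnorm_isolated (bounded_solutions A0 V A1) Y.
Proof.
move=> solY Yf; split => //; exists 1 => // Z solZ.
have [g Zg] : exists g, forall x, Z x = - hdot x g *: e1.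
  by case: solZ => lZ bZ _; exact: functional_representation.
have [l Bf] := bounded_solution_eigenvector solY Yf.
have [l' Bg] := bounded_solution_eigenvector solZ Zg.
have [ll'|ll'] := eqVneq l l'.
  move=> _; apply/funext => x; rewrite Yf Zg; congr (- hdot x _ *: _).
  rewrite -ll' in Bg; have ef : hdot e ((f, e1) : H) = 1.
    by rewrite hdot_dsum /= linear0l add0r.
  have := eigenspace_cyclic sB cyclic_e Bf Bg ef.
  rewrite hdot_dsum /= linear0l add0r e1_unit rmorph1 scale1r.
  by case.
have : hdot ((f, e1) : H) ((g, e1) : H) = 0 by exact: (eigen_ortho sB Bf Bg ll').
rewrite hdot_dsum /= e1_unit => fg.
set w := f - g.
have w1 : 1 <= sqn w.
  rewrite /w sqnB; have -> : rdot f g = -1.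
    have -> : rdot f g = complex.Re (hdot f g + 1 - 1) by rewrite addrK.
    by rewrite fg sub0r.
  have := sqn_ge0 f; have := sqn_ge0 g; lra.
set s := Num.sqrt (sqn w).
have s1 : 1 <= s by have := ler_wsqrtr w1; rewrite sqrtr1.
have s0 : 0 < s by exact: lt_le_trans s1.
have YZ x : (Z \- Y) x = hdot x w *: e1.
  by rewrite /= Yf Zg -scalerBl opprK addrC /w linearBr.
have YZn x : `|(Z \- Y) x| = `|hdot x w|.
  by rewrite YZ normrZ hilbert_normE sqn_e1 sqrtr1 mulr1.
rewrite ltNge => /negP[]; apply: le_trans s1 _.
apply: ub_le_sup.
  exists s => _ [x /= x1 <-]; have : `|(Z \- Y) x| <= s%:C.
    rewrite YZn; apply: le_trans (hdot_norm_le _ _) _.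
    by rewrite (hilbert_normE w) ler_piMl// ler0c sqrtr_ge0.
  by rewrite lecE /= => /andP[].
exists (s^-1%:C *: w).
  rewrite /= normrZ hilbert_normE -/s normc_def /= expr0n addr0 sqrtr_sqr.
  rewrite ger0_norm ?invr_ge0 ?sqrtr_ge0//.
  by rewrite -rmorphM /= mulVf// gt_eqF.
have -> : (Z \- Y) (s^-1%:C *: w) = s%:C *: e1.
  rewrite YZ linearZl_LR /= hdotxx; congr (_ *: _); rewrite -rmorphM /=.
  by rewrite -[sqn w]sqr_sqrtr ?sqn_ge0// -/s expr2 mulKf// gt_eqF.
rewrite normrZ (hilbert_normE e1) sqn_e1 sqrtr1 mulr1 normc_def /= expr0n addr0 sqrtr_sqr.
by rewrite ger0_norm// sqrtr_ge0.
Qed.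

End BoundedSolutions.

Lemma one_dimensional_unit (R : realType) (H : hilbertType R) :
  one_dimensional [set: H] ->
  exists2 e : H, hdot e e = 1 & forall y, y = hdot y e *: e.
Proof.
move=> [v v0 vH]; have sv : 0 < sqn v.
  rewrite lt0r sqn_ge0 andbT; apply: contraNN v0 => /eqP h.
  by rewrite (sqn_eq0 h).
set s := Num.sqrt (sqn v); have s0 : 0 < s by rewrite sqrtr_gt0.
set e := s^-1%:C *: v.
have e1 : hdot e e = 1.
  rewrite hdotxx /e sqnZ -[sqn v]sqr_sqrtr ?ltW// -/s -exprMn mulVf ?gt_eqF//.
  by rewrite expr1n.
exists e => // y; have : [set: H] y by [].
rewrite vH => -[a _ <-]; have -> : v = s%:C *: e.
  by rewrite /e scalerA -rmorphM /= divff ?scale1r// gt_eqF.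
by rewrite scalerA linearZl_LR /= e1 mulr1.
Qed.

(** * The graph orthogonal to an eigenvector *)

Section EigenGraph.
Variables (R : realType) (H0 H1 : hilbertType R).
Local Notation H := (dsum H0 H1).
Variable e1 : H1.
Hypotheses (e1_unit : hdot e1 e1 = 1) (e1_basis : forall y, y = hdot y e1 *: e1).
Variables (f : H0) (X : unbounded_op H0 H1).
Hypothesis XG : graph X = [set u | hdot u ((f, e1) : H) = 0].

Lemma ortho_graphE x : op_dom X x /\ X x = - hdot x f *: e1.
Proof.
apply/(graphP X (x, - hdot x f *: e1)); rewrite XG /=.
by rewrite hdot_dsum /= linearZl_LR /= e1_unit mulr1 subrr.
Qed.

Lemma codimension1_ortho : codimension1 [set u | hdot u ((f, e1) : H) = 0].
Proof.
split; first exact: subspace_ortho.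
have ef : hdot ((0, e1) : H) ((f, e1) : H) = 1.
  by rewrite hdot_dsum /= linear0l add0r.
exists (0, e1) => [/=|u].
  by rewrite ef => /eqP; rewrite oner_eq0.
exists (hdot u ((f, e1) : H)) => /=.
by rewrite linearBl /= [X in _ - X]linearZl_LR /= ef mulr1 subrr.
Qed.

Lemma ortho_graph_bounded_solution (A0 : {linear H0 -> H0}) (A1 : {linear H1 -> H1})
    (V : {linear H1 -> H0}) :
  strong_solution A0 V A1 X -> bounded_solutions A0 V A1 X.
Proof.
move=> sX; have XE x : X x = - hdot x f *: e1 by case: (ortho_graphE x).
split.
- move=> a x y; rewrite !XE linearPl opprD scalerDl scalerA.
  by rewrite mulrN.
- exists `|f| => x; rewrite XE normrZ normrN (hilbert_normE e1) {1}/sqn e1_unit sqrtr1 mulr1.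
  by rewrite mulrC hdot_norm_le.
- move=> x; have [_] := sX x (ortho_graphE x).1.
  have -> : X (A0 x + V (X x)) = X (A0 x) + X (V (X x)).
    by rewrite ![X (_ + _)]XE !XE linearDl opprD scalerDl.
  by rewrite opprD addrA.
Qed.

End EigenGraph.

Theorem theorem1 (R : realType) (H0 H1 : hilbertType R)
    (A0 : {linear H0 -> H0}) (A1 : {linear H1 -> H1}) (V : {linear H1 -> H0})
    (E : pvm (dsum H0 H1)) :
  separable_space (dsum H0 H1) ->
  one_dimensional [set: H1] ->
  bounded_op A0 -> selfadjoint A0 ->
  bounded_op A1 -> selfadjoint A1 ->
  bounded_op V ->
  one_dimensional (range V) ->
  cyclic_subspace A0 (range V) = [set: H0] ->
  is_spectral_measure (block_op A0 V A1) E ->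
  let B := block_op A0 V A1 in
  let Spp := eigenvalues B in
  exists (Ss : set R) (X : R -> unbounded_op H0 H1),
    let Psi l := graph (X l) in
    [/\ minimal_support (singular_part E) Ss, Spp `<=` Ss &
        forall l, Ss l -> densely_defined (X l)] /\
    [/\ forall l, (Ss `\` Spp) l ->
          [/\ dense (Psi l), ~ closed (Psi l), ~ closed_op (X l),
              densely_defined (X l) & strong_solution A0 V A1 (X l)],
        forall l, Spp l ->
          [/\ closed (Psi l), codimension1 (Psi l),
              op_dom (X l) = setT,
              bounded_solutions A0 V A1 (X l) &
              opnorm_isolated (bounded_solutions A0 V A1) (X l)],
        forall l, Ss l -> invariant_subspace B (Psi l) &
        set_inj Ss Psi].
Proof.
move=> sepH dimH1 _ sA0 _ sA1 _ _ cycV EB B0 Spp.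
have [e1 e1_unit e1_basis] := one_dimensional_unit dimH1.
have [B BE] := block_op_linear A0 A1 V e1_basis.
have sB : selfadjoint B by rewrite BE; exact: (block_op_selfadjoint V e1_basis).
rewrite {}/Spp {}/B0 -BE; rewrite -BE in EB.
set e : dsum H0 H1 := (0, e1).
have cyclic_e (L : set (dsum H0 H1)) : subspace_of L -> closed L ->
    (forall x, L x -> L (B x)) -> L e -> forall x, L x.
  by rewrite BE; exact: (block_op_cyclic e1_basis).
have [Ss [Smin SppS Ssc]] := singular_support sB cyclic_e EB sepH.
have Psi_e l a : Ss l -> Psi B l (a *: e) -> a = 0.
  move=> Sl; apply: (Psi_cyclic sB cyclic_e).
  by have [ev|nev] := pselect (eigenvalues B l); [left|right; exact: Ssc].
have notPsi l : Ss l -> ~ Psi B l e.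
  move=> Sl; rewrite -[e]scale1r => /(Psi_e _ _ Sl)/eqP.
  by rewrite oner_eq0.
have /choice[X XP] (l : R) : exists X : unbounded_op H0 H1,
    Ss l -> graph X = Psi B l.
  have [Sl|nSl] := pselect (Ss l).
    have [|X XG] := subspace_graph (Psi_subspace B l); last by exists X.
    move=> y; rewrite (e1_basis y) => Py.
    rewrite (Psi_e l (hdot y e1) Sl) ?scale0r//.
    by rewrite -[_ *: e]/(hdot y e1 *: (0 : H0), hdot y e1 *: e1) scaler0.
  (* Outside [Ss] any operator will do; the one with zero graph is taken. *)
  have sL0 : subspace_of [set (0 : dsum H0 H1)].
    by split=> // a x y -> ->; rewrite scaler0 addr0.
  by have [|X _] := subspace_graph sL0; [move=> y []|exists X].
have invX l u : Ss l -> graph (X l) u -> graph (X l) (B u).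
  by move=> Sl; rewrite XP//; exact: Psi_invariant.
have strongX l : Ss l -> strong_solution A0 V A1 (X l).
  by move=> Sl; apply: graph_strong_solution => u; rewrite -BE; exact: invX.
have eigenX l : eigenvalues B l -> exists f : H0,
    graph (X l) = [set u | hdot u ((f, e1) : dsum H0 H1) = 0].
  move=> ev; have [[f f2] ef Bf] := normalized_eigenvector sB cyclic_e ev.
  have f2E : f2 = e1.
    move: ef; rewrite hdot_dsum /= linear0l add0r => ef.
    by rewrite [LHS]e1_basis hdotC ef rmorph1 scale1r.
  exists f; rewrite XP; last exact: SppS.
  by rewrite (Psi_eigen sB cyclic_e Bf ef) f2E.
have denseX l : (Ss `\` eigenvalues B) l -> dense (graph (X l)).
  by move=> [Sl nev]; rewrite XP//; exact: Psi_dense.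
exists Ss, X => /=; split.
  split=> // l Sl; have [ev|nev] := pselect (eigenvalues B l).
    have [f XG] := eigenX l ev; have XD := ortho_graphE e1_unit XG.
    by apply/dense_closureP => p; apply: subset_closure; case: (XD p).
  exact/dense_graph_dom/denseX.
split.
- move=> l Sl; have dX := denseX l Sl; have [Sl1 nev] := Sl.
  (* A closed dense graph would be the whole space and contain e. *)
  have ncl : ~ closed (graph (X l)).
    move=> /closed_closureP cX; apply: (notPsi l Sl1); rewrite -XP//.
    by apply: cX; move/dense_closureP: dX; apply.
  split=> //; first exact: dense_graph_dom.
  exact: strongX.
- move=> l ev; have [f XG] := eigenX l ev.
  have Xsol := ortho_graph_bounded_solution e1_unit XG (strongX l (SppS l ev)).
  split=> //.
  + by rewrite XG; exact: closed_ortho.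
  + by rewrite XG; exact: codimension1_ortho.
  + by apply/seteqP; split => // x _; case: (ortho_graphE e1_unit XG x).
  + apply: (bounded_solution_isolated (f := f) e1_unit e1_basis sA0 sA1 cycV BE Xsol).
    by move=> x; case: (ortho_graphE e1_unit XG x).
- move=> l Sl; split; first by rewrite XP//; exact: Psi_subspace.
  by move=> _ [u Xu <-]; exact: invX.
- move=> l l'; rewrite !inE => Sl Sl'; rewrite !XP//.
  exact: (Psi_inj sB (notPsi l Sl)).
Qed.
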